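(* Let $M$ be a closed manifold, $E\in\Psi^\nu_{+e}(M)$ with $\nu>0$, and let $0<r<\infty$. A bounded linear operator $T:L^2(M)\to L^2(M)$ which is invariant relative to $E$ is in the Schatten class $S_r(L^2(M))$ if and only if its symbol $\sigma_T$ satisfies $$\sum_{\ell=0}^\infty\|\sigma_T(\ell)\|_{S_r}^r<\infty.$$ Moreover, $$\|T\|_{S_r(L^2(M))}^r=\sum_{\ell=0}^\infty\|\sigma_T(\ell)\|_{S_r}^r .$$ If an invariant operator $T:L^2(M)\to L^2(M)$ is in the trace class $S_1(L^2(M))$, then $$\operatorname{Tr}(T)=\sum_{\ell=0}^\infty\operatorname{Tr}(\sigma_T(\ell)).$$
   Context: $M$ is a closed smooth manifold (compact, without boundary) endowed with a positive measure $dx$ given by a smooth positive density; $L^2(M)=L^2(M,dx)$ with inner product $(\cdot,\cdot)$, linear in the first argument. $\Psi^\nu_{+e}(M)$ is the class of classical pseudo-differential operators of order $\nu$ on $M$ that are elliptic and positive (the eigenvalue $0$ is allowed). The eigenvalues of $E$, without multiplicities, are ordered $0=\lambda_0<\lambda_1<\lambda_2<\cdots$; $H_j$ is the finite-dimensional eigenspace of $\lambda_j$, $H_0=\ker E$, $d_j=\dim H_j$. A basis $\{e_j^k\}_{j\ge0}^{1\le k\le d_j}$ of $L^2(M)$ is fixed such that $\{e_j^k\}_{1\le k\le d_j}$ is an orthonormal basis of $H_j$. Fourier coefficients: $\widehat f(j,k)=(f,e_j^k)$ and $\widehat f(j)=(\widehat f(j,1),\dots,\widehat f(j,d_j))^\top\in\mathbb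 C^{d_j}$. An operator $T$ is invariant relative to $E$ if for each $\ell\in\mathbb N_0$ there is a matrix $\sigma_T(\ell)\in\mathbb C^{d_\ell\times d_\ell}$ such that $\widehat{Tf}(\ell)=\sigma_T(\ell)\widehat f(\ell)$ for all $f\in C^\infty(M)$; the family $\sigma_T=(\sigma_T(\ell))_{\ell\ge0}$ is its (matrix-valued) symbol. For $0<r<\infty$, $S_r$ is the class of compact operators with $r$-summable singular values $s_j$, and $\|\cdot\|_{S_r}=(\sum_j s_j^r)^{1/r}$ (a quasi-norm if $r<1$); $\|\sigma_T(\ell)\|_{S_r}$ is this quantity for the matrix $\sigma_T(\ell)$ acting on $\mathbb C^{d_\ell}$. *)

(* Defs.v *)
From HB Require Import structures.
From mathcomp Require Import all_boot all_order all_algebra.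
From mathcomp Require Import generic_quotient ring_quotient.
From mathcomp Require Import all_classical all_reals all_analysis.
From mathcomp Require Import complex.

Set Implicit Arguments.
Unset Strict Implicit.
Unset Printing Implicit Defensive.

Import Order.TTheory GRing.Theory Num.Theory.
Import numFieldNormedType.Exports.

Local Open Scope classical_set_scope.
Local Open Scope ring_scope.

Notation Re := (@complex.Re _).
Notation Im := (@complex.Im _).

Definition on_parts {R : realType} {X : Type} (P : (X -> R) -> Prop)
  (f : X -> R[i]) : Prop := P (Re \o f) /\ P (Im \o f).

Definition cvgc {R : realType} (u : nat -> R[i]) (l : R[i]) : Prop :=
  (Re \o u) @ \oo --> Re l /\ (Im \o u) @ \oo --> Im l.

(* A complex Hilbert space is an [lmodType] with its inner product [dot], linear
   in the first argument, passed explicitly.  This applies both to [L^2(M)] and to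
   [C^d]. *)

Section Hilbert.
Context {R : realType} {V : lmodType R[i]} (dot : V -> V -> R[i]).

Definition hnorm (x : V) : R := Num.sqrt (Re (dot x x)).

Definition bounded_operator (T : V -> V) : Prop :=
  exists c : R, forall x, hnorm (T x) <= c * hnorm x.

Definition compact_operator (T : V -> V) : Prop :=
  forall u : nat -> V, (exists c : R, forall k, hnorm (u k) <= c) ->
  exists (phi : nat -> nat) (y : V),
    {homo phi : k l / (k < l)%N} /\
    (fun k => hnorm (T (u (phi k)) - y)) @ \oo --> (0 : R).

(* [T^* y = z] *)
Definition adjoint_at (T : V -> V) (y z : V) : Prop :=
  forall x, dot (T x) y = dot x z.

(* [ker (T^* T - s^2)]: for [s > 0], [s] is a singular value of [T] if and only
   if this space is nonzero, and its dimension is the multiplicity of [s]. *)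
Definition singular_space (T : V -> V) (s : R) : set V :=
  [set x | adjoint_at T (T x) ((s ^+ 2)%:C%C *: x)].

Definition lin_indep (k : nat) (v : 'I_k -> V) : Prop :=
  forall c : 'I_k -> R[i], \sum_i c i *: v i = 0 -> forall i, c i = 0.

Definition vdim (S : set V) : \bar R :=
  ereal_sup [set k%:R%:E | k in
    [set k | exists v : 'I_k -> V, (forall i, S (v i)) /\ lin_indep v]].

(* [(sum_j s_j ^ r) ^ (1/r)], the singular values [s_j] being counted with
   multiplicity; the zero ones do not contribute.  Operators that are not
   compact get the value [+oo]. *)
Definition schatten_norm (r : R) (T : V -> V) : \bar R :=
  if `[< compact_operator T >] then
    poweR (\esum_(s in [set s : R | 0 < s])
             (vdim (singular_space T s) * (s `^ r)%:E)%E) r^-1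
  else +oo%E.

Definition schatten_class (r : R) (T : V -> V) : Prop :=
  compact_operator T /\ (schatten_norm r T < +oo)%E.

(* Indexing by a subset of [nat] covers every separable space, of finite or of
   infinite dimension. *)
Definition orthonormal_basis (D : set nat) (phi : nat -> V) : Prop :=
  (forall i j, D i -> D j -> dot (phi i) (phi j) = (i == j)%:R) /\
  (forall (x : V) (eps : R), 0 < eps -> exists N (c : nat -> R[i]),
     hnorm (x - \sum_(0 <= i < N | i \in D) c i *: phi i) < eps).

(* [Tr T = t]: the sum of the [(T phi_i, phi_i)] is [t] for every orthonormal
   basis. *)
Definition has_trace (T : V -> V) (t : R[i]) : Prop :=
  forall (D : set nat) (phi : nat -> V), orthonormal_basis D phi ->
  cvgc (fun N => \sum_(0 <= i < N | i \in D) dot (T (phi i)) (phi i)) t.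

End Hilbert.

Definition cVdot {R : realType} {d : nat} (x y : 'cV[R[i]]_d) : R[i] :=
  \sum_i x i 0 * (y i 0)^*%C.

(* The library's L^p spaces are real; [L2] is the space of the square-integrable
   complex functions modulo equality almost everywhere. *)

Section L2.
Context {disp : measure_display} {X : measurableType disp} {R : realType}.
Variable mu : {measure set X -> \bar R}.

Definition sqint : {pred X -> R[i]} :=
  [pred f | (Re \o f \in Lfun mu 2%:E) && (Im \o f \in Lfun mu 2%:E)].

Lemma sqint_submod_closed : submod_closed sqint.
Proof.
have le12 : (1 <= 2%:E :> \bar R)%E by rewrite lee_fin ler1n.
have [L0 LZD] := Lfun_submod_closed mu le12.
split.
  by apply/andP; split;
    (rewrite (_ : _ \o _ = 0); [exact: L0 | exact/funext]).
move=> a f g /andP[fr fi] /andP[gr gi]; apply/andP; split.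
  rewrite (_ : _ \o _ = Re a *: (Re \o f) + ((- Im a) *: (Im \o f) + (Re \o g))).
    exact/LZD/LZD.
  apply/funext => x /=; rewrite !fctE /=.
  case: a (f x) (g x) => [? ?] [? ?] [? ?].
  by rewrite /GRing.scale /= mulNr addrA.
rewrite (_ : _ \o _ = Re a *: (Im \o f) + (Im a *: (Re \o f) + (Im \o g))).
  exact/LZD/LZD.
apply/funext => x /=; rewrite !fctE /=.
case: a (f x) (g x) => [? ?] [? ?] [? ?].
by rewrite /GRing.scale /= addrA.
Qed.

HB.instance Definition _ :=
  GRing.isSubmodClosed.Build _ _ sqint sqint_submod_closed.

Record sqfun := SqFun { sqfun_val :> X -> R[i]; _ : sqfun_val \in sqint }.

HB.instance Definition _ := [isSub for sqfun_val].
HB.instance Definition _ := [Choice of sqfun by <:].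
HB.instance Definition _ := [SubChoice_isSubLmodule of sqfun by <:].

Definition nullfun : {pred sqfun} :=
  [pred f : sqfun | `[< {ae mu, forall x, f x = 0} >]].

Lemma nullfun_zmod_closed : zmod_closed nullfun.
Proof.
split; first by apply/asboolP; apply: aeW.
move=> f g /asboolP f0 /asboolP g0; apply/asboolP.
by apply: filterS2 f0 g0 => x /= fx gx; rewrite !fctE fx gx subrr.
Qed.

HB.instance Definition _ :=
  GRing.isZmodClosed.Build _ nullfun nullfun_zmod_closed.

Definition L2 : Type := Quotient.quot nullfun.

HB.instance Definition _ := GRing.Zmodule.on L2.
HB.instance Definition _ := EqQuotient.on L2.

Local Open Scope quotient_scope.

Definition L2scale (a : R[i]) (u : L2) : L2 := \pi_L2 (a *: repr u).

Lemma eqL2P (f g : sqfun) : reflect (f = g %[mod L2]) (f - g \in nullfun).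
Proof. by rewrite Quotient.idealrBE; exact: eqP. Qed.

Lemma nullfunZ a (f : sqfun) : f \in nullfun -> a *: f \in nullfun.
Proof.
move=> /asboolP f0; apply/asboolP; apply: filterS f0 => x /= fx.
by rewrite !fctE fx scaler0.
Qed.

Lemma pi_L2scale a (f : sqfun) : L2scale a (\pi_L2 f) = \pi_L2 (a *: f).
Proof.
apply/eqL2P; rewrite -scalerBr; apply: nullfunZ; apply/eqL2P.
by rewrite reprK.
Qed.

Lemma L2scaleA a b u : L2scale a (L2scale b u) = L2scale (a * b) u.
Proof.
rewrite -[u]reprK; move: (repr u) => f.
by rewrite [L2scale b _]pi_L2scale !pi_L2scale scalerA.
Qed.

Lemma L2scale1 : left_id 1 L2scale.
Proof. by move=> u; rewrite -[u]reprK; move: (repr u) => f; rewrite pi_L2scale scale1r. Qed.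

Lemma L2scaleDr : right_distributive L2scale +%R.
Proof.
move=> a u v; rewrite -[u]reprK -[v]reprK.
move: (repr u) (repr v) => f g.
have piD (x y : sqfun) : \pi_L2 x + \pi_L2 y = \pi_L2 (x + y) :> L2.
  by rewrite [RHS]Quotient.pi_add.
by rewrite piD !pi_L2scale piD scalerDr.
Qed.

Lemma L2scaleDl u : {morph L2scale^~ u : a b / a + b}.
Proof.
move=> a b; rewrite -[u]reprK; move: (repr u) => f.
by rewrite !pi_L2scale scalerDl [LHS]Quotient.pi_add.
Qed.

HB.instance Definition _ := GRing.Zmodule_isLmodule.Build R[i] L2
  L2scaleA L2scale1 L2scaleDr L2scaleDl.

Definition L2fun (u : L2) : X -> R[i] := repr u.

Definition inner (f g : X -> R[i]) : R[i] :=
  let h x := f x * (g x)^*%C in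
  Complex (Rintegral mu setT (Re \o h)) (Rintegral mu setT (Im \o h)).

Definition L2dot (u v : L2) : R[i] := inner (L2fun u) (L2fun v).

End L2.

Section Euclidean.
Context {R : realType}.

(* The iterated partial derivatives, indexed by words: [partials [:: i; j] f] is
   the [i]-th partial derivative of the [j]-th partial derivative of [f]. *)
Definition partials {m : nat} (w : seq 'I_m) (f : 'rV[R]_m -> R) :
    'rV[R]_m -> R :=
  foldr (fun i g x => 'D_(delta_mx 0 i) g x) f w.

(* [f] is of class [C^oo] on the open set [U]; the values of [f] outside [U] are
   irrelevant. *)
Definition smooth_on {m : nat} (U : set 'rV[R]_m) (f : 'rV[R]_m -> R) : Prop :=
  forall (w : seq 'I_m) (x : 'rV[R]_m), U x ->
    {for x, continuous (partials w f)} /\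
    forall i, derivable (partials w f) x (delta_mx 0 i).

Definition csmooth_on {m : nat} (U : set 'rV[R]_m) (f : 'rV[R]_m -> R[i]) :
  Prop := on_parts (smooth_on U) f.

(* Iterated Lebesgue integral.  It is applied below to nonnegative Borel
   functions and to absolutely integrable continuous functions, for which it is
   the integral against the Lebesgue measure of [R^m]. *)
Fixpoint integralRn (m : nat) : ('rV[R]_m -> \bar R) -> \bar R :=
  match m with
  | 0 => fun f => f 0
  | k.+1 => fun f =>
      (\int[lebesgue_measure]_(t in [set: R])
          integralRn (fun x : 'rV[R]_k => f (row_mx (t%:M : 'rV[R]_1) x)))%E
  end.

Definition cintegralRn {m : nat} (f : 'rV[R]_m -> R[i]) : R[i] :=
  Complex (fine (integralRn (EFin \o (Re \o f))))
          (fine (integralRn (EFin \o (Im \o f)))).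

Definition dotRn {m : nat} (x xi : 'rV[R]_m) : R := \sum_i x 0 i * xi 0 i.

Definition expi (t : R) : R[i] := Complex (cos t) (sin t).

Definition test_function {m : nat} (U : set 'rV[R]_m) (u : 'rV[R]_m -> R[i]) :
    Prop :=
  csmooth_on [set: 'rV[R]_m] u /\
  exists2 K : set 'rV[R]_m, compact K /\ K `<=` U & forall x, ~ K x -> u x = 0.

Definition fourier {m : nat} (u : 'rV[R]_m -> R[i]) (xi : 'rV[R]_m) : R[i] :=
  cintegralRn (fun y => expi (- dotRn y xi) * u y).

(* A function of [(x, xi)] in [R^n * R^n] is a function on ['rV_(n + n)], evaluated
   at [row_mx x xi]. *)

Definition prodset {m : nat} (U W : set 'rV[R]_m) : set 'rV[R]_(m + m) :=
  [set z | U (lsubmx z) /\ W (rsubmx z)].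

Definition pdo {m : nat} (a : 'rV[R]_(m + m) -> R[i]) (u : 'rV[R]_m -> R[i])
    (x : 'rV[R]_m) : R[i] :=
  (((2 * pi) ^+ m)^-1)%:C%C *
  cintegralRn (fun xi => expi (dotRn x xi) * a (row_mx x xi) * fourier u xi).

(* The number of derivatives in the variable [xi]. *)
Definition xi_order {m : nat} (w : seq 'I_(m + m)) : nat :=
  count (fun i : 'I_(m + m) => (m <= i)%N) w.

(* The estimates of the class [S^nu (U * R^n)], for large [xi] only: for [xi] in
   a bounded set they hold for every smooth function. *)
Definition symbol_estimates {m : nat} (U : set 'rV[R]_m) (nu : R)
    (a : 'rV[R]_(m + m) -> R) : Prop :=
  forall (w : seq 'I_(m + m)) (K : set 'rV[R]_m), compact K -> K `<=` U ->
  exists c : R, forall x xi : 'rV[R]_m, K x -> 1 <= `|xi| ->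
    `|partials w a (row_mx x xi)| <= c * `|xi| `^ (nu - (xi_order w)%:R).

(* [a] is a classical symbol of order [nu], with asymptotic expansion
   [sum_j ah j], where [ah j] is homogeneous of degree [nu - j] in [xi]; the
   principal symbol is [ah 0]. *)
Definition classical_symbol {m : nat} (U : set 'rV[R]_m) (nu : R)
    (a : 'rV[R]_(m + m) -> R[i]) (ah : nat -> 'rV[R]_(m + m) -> R[i]) : Prop :=
  [/\ csmooth_on (prodset U [set: 'rV[R]_m]) a,
      forall j, csmooth_on (prodset U [set xi | xi != 0]) (ah j),
      forall j x xi (t : R), U x -> xi != 0 -> 0 < t ->
        ah j (row_mx x (t *: xi)) =
        (t `^ (nu - j%:R))%:C%C * ah j (row_mx x xi)
    & forall N, on_parts (symbol_estimates U (nu - N%:R))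
        (fun z => a z - \sum_(j < N) ah j z)].

End Euclidean.

Section Manifold.
Context {R : realType} {n : nat} {M : ptopologicalType}.

(* [chart_map] matters on [chart_dom] only and [chart_inv] on its image only.
   The domain of a chart need not be connected. *)
Record chart := Chart {
  chart_dom : set M;
  chart_map : M -> 'rV[R]_n;
  chart_inv : 'rV[R]_n -> M }.

Definition chart_img (c : chart) : set 'rV[R]_n := chart_map c @` chart_dom c.

Definition homeo_chart (c : chart) : Prop :=
  [/\ open (chart_dom c), open (chart_img c),
      forall p, chart_dom c p -> chart_inv c (chart_map c p) = p,
      forall p, chart_dom c p -> {for p, continuous (chart_map c)}
    & forall x, chart_img c x -> {for x, continuous (chart_inv c)}].

Definition smooth_transition (c c' : chart) : Prop :=
  forall i : 'I_n,
    smooth_on (chart_map c @` (chart_dom c `&` chart_dom c'))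
      (fun x => chart_map c' (chart_inv c x) 0 i).

Definition smooth_atlas (A : set chart) : Prop :=
  [/\ forall c, A c -> homeo_chart c,
      forall p, exists2 c, A c & chart_dom c p
    & forall c c', A c -> A c' -> smooth_transition c c'].

(* Second countability follows from compactness. *)
Definition closed_manifold (A : set chart) : Prop :=
  [/\ hausdorff_space M, compact [set: M] & smooth_atlas A].

(* [c] belongs to the maximal atlas. *)
Definition chart_of (A : set chart) (c : chart) : Prop :=
  homeo_chart c /\
  forall c', A c' -> smooth_transition c c' /\ smooth_transition c' c.

Definition smooth (A : set chart) (f : M -> R[i]) : Prop :=
  forall c, A c -> csmooth_on (chart_img c) (f \o chart_inv c).

Definition borel : Type := g_sigma_algebraType (@open M).
HB.instance Definition _ := Measurable.on borel.

(* In every chart, [mu] has a smooth positive density with respect to the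
   Lebesgue measure. *)
Definition smooth_positive_density (A : set chart)
    (mu : {measure set borel -> \bar R}) : Prop :=
  forall c, A c -> exists rho : 'rV[R]_n -> R,
    [/\ smooth_on (chart_img c) rho,
        forall x, chart_img c x -> 0 < rho x
      & forall B : set borel, measurable B -> B `<=` chart_dom c ->
          mu B = integralRn (fun x =>
            if x \in chart_map c @` B then (rho x)%:E else 0%E)].

(* An operator on [C^oo(M)] is a map [E : (M -> C) -> (M -> C)], whose values
   matter on smooth functions only. *)

Definition smooth_operator (A : set chart) (E : (M -> R[i]) -> (M -> R[i])) :
    Prop :=
  (forall f, smooth A f -> smooth A (E f)) /\
  (forall (a : R[i]) f g, smooth A f -> smooth A g ->
    E (a *: f + g) = a *: E f + E g).

Definition chart_lift (c : chart) (u : 'rV[R]_n -> R[i]) : M -> R[i] :=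
  fun p => if p \in chart_dom c then u (chart_map c p) else 0.

(* In the chart [c], the operator [E] is the pseudo-differential operator with
   the classical symbol [a], up to an operator with smooth kernel [k]. *)
Definition local_symbol (c : chart) (nu : R) (E : (M -> R[i]) -> (M -> R[i]))
    (a : 'rV[R]_(n + n) -> R[i]) (ah : nat -> 'rV[R]_(n + n) -> R[i]) : Prop :=
  classical_symbol (chart_img c) nu a ah /\
  exists2 k : 'rV[R]_(n + n) -> R[i],
      csmooth_on (prodset (chart_img c) (chart_img c)) k
    & forall u, test_function (chart_img c) u ->
      forall x, chart_img c x ->
        E (chart_lift c u) (chart_inv c x) =
        pdo a u x + cintegralRn (fun y => k (row_mx x y) * u y).

(* Any two points of [M] lie in the domain of some chart of the maximal atlas, so
   that this also makes the kernel of [E] smooth off the diagonal. *)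
Definition classical_psdo (A : set chart) (nu : R)
    (E : (M -> R[i]) -> (M -> R[i])) : Prop :=
  smooth_operator A E /\
  forall c, chart_of A c -> exists a ah, local_symbol c nu E a ah.

Definition elliptic (A : set chart) (nu : R)
    (E : (M -> R[i]) -> (M -> R[i])) : Prop :=
  forall c, chart_of A c -> forall a ah, local_symbol c nu E a ah ->
  forall x xi, chart_img c x -> xi != 0 -> ah 0%N (row_mx x xi) != 0.

Definition positive_operator (A : set chart)
    (mu : {measure set borel -> \bar R}) (E : (M -> R[i]) -> (M -> R[i])) :
    Prop :=
  forall f, smooth A f -> 0 <= inner mu (E f) f.

Definition Psi_pe (A : set chart) (mu : {measure set borel -> \bar R}) (nu : R)
    (E : (M -> R[i]) -> (M -> R[i])) : Prop :=
  [/\ classical_psdo A nu E, elliptic A nu E & positive_operator A mu E].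

(* [0 = lam 0 < lam 1 < ...] are the eigenvalues of [E], where [lam 0 = 0] is
   listed even if [ker E = 0] (and then [d 0 = 0]); [(e j k)_k] is an orthonormal
   basis of the eigenspace of [lam j], and all of them together form a basis of
   [L^2(M)].  The eigenfunctions of [E] are smooth. *)
Record eigenbasis (A : set chart) (mu : {measure set borel -> \bar R})
    (E : (M -> R[i]) -> (M -> R[i])) (lam : nat -> R) (d : nat -> nat)
    (e : forall j, 'I_(d j) -> M -> R[i]) : Prop := Eigenbasis {
  lam0 : lam 0%N = 0;
  lam_increasing : {homo lam : i j / (i < j)%N >-> i < j};
  lam_eigenvalue : forall j, (0 < j)%N -> (0 < d j)%N;
  lam_exhaustive : forall (z : R[i]) f, smooth A f -> f <> 0 -> E f = z *: f ->
    exists j, z = (lam j)%:C%C;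
  e_smooth : forall j k, smooth A (e j k);
  e_eigen : forall j k, E (e j k) = (lam j)%:C%C *: e j k;
  e_span : forall j f, smooth A f -> E f = (lam j)%:C%C *: f ->
    exists c : 'I_(d j) -> R[i], f = \sum_k c k *: e j k;
  e_orthonormal : forall j k k', inner mu (e j k) (e j k') = (k == k')%:R;
  e_total : forall (f : M -> R[i]) (eps : R), f \in sqint mu -> 0 < eps ->
    exists N (c : forall j, 'I_(d j) -> R[i]),
      hnorm (inner mu) (f - \sum_(j < N) \sum_k c j k *: e j k) < eps }.

Definition fcoef (mu : {measure set borel -> \bar R}) (d : nat -> nat)
    (e : forall j, 'I_(d j) -> M -> R[i]) (f : M -> R[i]) (j : nat) :
    'cV[R[i]]_(d j) :=
  \col_k inner mu f (e j k).

(* [T] is invariant relative to [E], with symbol [sigma]; [u] ranges over the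
   classes of the functions [f] in [C^oo(M)]. *)
Definition invariant_with_symbol (A : set chart)
    (mu : {measure set borel -> \bar R}) (d : nat -> nat)
    (e : forall j, 'I_(d j) -> M -> R[i]) (T : L2 mu -> L2 mu)
    (sigma : forall l, 'M[R[i]]_(d l)) : Prop :=
  forall (f : M -> R[i]) (u : L2 mu), smooth A f ->
    {ae mu, forall x, L2fun u x = f x} ->
    forall l, fcoef mu e (L2fun (T u)) l = sigma l *m fcoef mu e f l.

End Manifold.

Arguments chart : clear implicits.
Arguments borel : clear implicits.

(* Main.v *)
(** An operator [T] commuting with the spectral decomposition of [E] acts on the
eigenspace [H_l] as the matrix [sigma l].  Diagonalising each
[(sigma l)^* (sigma l)] by a unitary matrix and transporting the columns to
[L^2(M)] gives an orthonormal basis [w] of [L^2(M)] that diagonalises [T^* T],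
[(T x, T w_i) = s_i^2 (x, w_i)].  So the multiplicity of [s > 0] as a singular
value of [T] is the number of [i] with [s_i = s], and the sum of the [r]-th powers
of the singular values is the sum of the [s_i ^ r], which splits into the
contributions of the blocks.  If it is finite then [T] is a norm limit of
finite-rank operators, hence compact: this uses that [L^2(M)] is complete.
If [sum_i s_i < +oo] then, for an orthonormal basis [phi],
[(T phi_j, phi_j) = sum_i (phi_j, w_i) (T w_i, phi_j)]; by Cauchy-Schwarz and
Bessel the terms of index [i] contribute at most [|T w_i| = s_i], uniformly in the
number of [j]'s, and they add up to [(T w_i, w_i)] by Parseval, so the trace can be
computed in the basis [w].
The eigenspaces are orthogonal because a positive operator on a complex space is
symmetric, by polarisation. *)

From HB Require Import structures.
From mathcomp Require Import all_boot all_order all_algebra.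
From mathcomp Require Import generic_quotient ring_quotient.
From mathcomp Require Import finmap all_classical all_reals all_analysis.
From mathcomp Require Import measurable_realfun complex ring lra.
Require Import Defs.

Set Implicit Arguments.
Unset Strict Implicit.
Unset Printing Implicit Defensive.

Import Order.TTheory GRing.Theory Num.Theory.
Import numFieldNormedType.Exports.
Import Normc.

(* [Num.Theory] shadows the notations [Re] and [Im] of [Defs]. *)
Local Notation Re := (@complex.Re _).
Local Notation Im := (@complex.Im _).

Local Open Scope classical_set_scope.
Local Open Scope ring_scope.
Local Open Scope sesquilinear_scope.

(** * Inner product spaces and orthonormal families *)

(** The blocks [sigma l] need not be normal, so they need not be unitarily diagonalisable; the
    Schatten quantity of a block is moreover defined by the same singular spaces as that of [T].
    Hence the theory of operators with T^* T diagonal is developed for an arbitrary inner product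
    and applied twice, to [T] on L^2(M) and to each [sigma l] on C^(d l), with the same numbers s_i.
    The adjoint of [T] is never constructed: T^* T w_i = s_i^2 w_i enters in its weak form only. All
    comparisons are between sums of nonnegative extended reals, so that r < 1, where only a
    quasi-norm is at hand, is no special case. Invariance speaks of smooth functions; boundedness of
    [T] and density of the span of the eigenfunctions carry it to all of L^2(M), by way of (T x,
    embed z) = (x, embed (sigma^* z)). The independence of the trace from the basis comes directly
    from the absolute convergence of the sum of the |T w_i|, without factoring [T] through
    Hilbert-Schmidt operators. *)

Section complex_modulus.
Context {R : realType}.
Implicit Types z : R[i].

Lemma norm_normc (z : R[i]) : `|z| = (normc z)%:C%C.
Proof. by []. Qed.

Lemma normc_ge0 z : 0 <= normc z.
Proof. by case: z => a b; exact: sqrtr_ge0. Qed.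

Lemma normc_conj z : normc z^*%C = normc z.
Proof. by case: z => a b /=; rewrite sqrrN. Qed.

Lemma conjcM (x y : R[i]) : (x * y)^*%C = x^*%C * y^*%C.
Proof. exact: (rmorphM (@conjc R)). Qed.

Lemma real_complexM (a b : R) : (a * b)%:C%C = a%:C%C * b%:C%C.
Proof. exact: (rmorphM (real_complex R)). Qed.

Lemma normc_sqr z : (normc z ^+ 2)%:C%C = z * z^*%C.
Proof.
by rewrite -sqr_normc norm_normc rmorphXn.
Qed.

Lemma normc_real (a : R) : normc a%:C%C = `|a|.
Proof. by rewrite /= expr0n addr0 sqrtr_sqr. Qed.

Lemma Re_le_normc z : `|Re z| <= normc z.
Proof. by have := normc_ge_Re z; rewrite norm_normc lecR. Qed.

Lemma Im_le_normc z : `|Im z| <= normc z.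
Proof.
case: z => a b /=; rewrite -(sqrtr_sqr b).
by rewrite ler_sqrt ?lerDr ?sqr_ge0// addr_ge0 ?sqr_ge0.
Qed.

Lemma normc_le_ReIm z : normc z <= `|Re z| + `|Im z|.
Proof.
case: z => a b /=; rewrite -(ler_pXn2r (n := 2)) ?nnegrE ?sqrtr_ge0//.
rewrite sqr_sqrtr ?addr_ge0 ?sqr_ge0// sqrrD -!normrX.
rewrite !(ger0_norm (sqr_ge0 _)) lerD2r lerDl mulrn_wge0//.
Qed.

Lemma normc_sum (I : Type) (F : seq I) (P : pred I) (f : I -> R[i]) :
  normc (\sum_(i <- F | P i) f i) <= \sum_(i <- F | P i) normc (f i).
Proof.
elim/big_rec2: _ => [|i y1 y2 _ h]; first by rewrite normc0.
by rewrite (le_trans (le_normcD _ _)) ?lerD2l.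
Qed.

Lemma Re_sum (I : Type) (F : seq I) (P : pred I) (f : I -> R[i]) :
  Re (\sum_(i <- F | P i) f i) = \sum_(i <- F | P i) Re (f i).
Proof. by elim/big_rec2: _ => // i y [a b] _ <-; case: (f i). Qed.

End complex_modulus.

(** In the order of [R[i]], [ip_ge0] also says that [dot x x] is real. *)
Record inner_product {R : realType} {V : lmodType R[i]} (dot : V -> V -> R[i]) :
    Prop := InnerProduct {
  ip_linear : forall a x y z, dot (a *: x + y) z = a * dot x z + dot y z;
  ip_conj : forall x y, dot y x = (dot x y)^*%C;
  ip_ge0 : forall x, 0 <= dot x x;
  ip_eq0 : forall x, dot x x = 0 -> x = 0 }.

Definition hcomplete {R : realType} {V : lmodType R[i]} (dot : V -> V -> R[i]) :=
  forall u : nat -> V,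
    (forall eps : R, 0 < eps -> exists N, forall m n, (N <= m)%N -> (N <= n)%N ->
      hnorm dot (u m - u n) < eps) ->
  exists y, (fun n => hnorm dot (u n - y)) @ \oo --> (0 : R).

(** The general index covers both kinds of bases in use: those indexed by pairs of a block and a
    position, with [D = setT], and those of [has_trace], indexed by a subset of [nat]. *)
Definition orthonormal {R : realType} {V : lmodType R[i]} (dot : V -> V -> R[i])
    {I : eqType} (D : set I) (w : I -> V) :=
  forall i j, D i -> D j -> dot (w i) (w j) = (i == j)%:R.

Definition total {R : realType} {V : lmodType R[i]} (dot : V -> V -> R[i])
    {I : eqType} (D : set I) (w : I -> V) :=
  forall (x : V) (eps : R), 0 < eps -> exists (F : seq I) (c : I -> R[i]),
    {in F, forall i, D i} /\ hnorm dot (x - \sum_(i <- F) c i *: w i) < eps.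

Section inner_product_theory.
Context {R : realType} {V : lmodType R[i]} (dot : V -> V -> R[i]).
Hypothesis ip : inner_product dot.
Local Notation N := (hnorm dot).

Lemma dotDl x y z : dot (x + y) z = dot x z + dot y z.
Proof. by have := ip_linear ip 1 x y z; rewrite scale1r mul1r. Qed.

Lemma dot0l z : dot 0 z = 0.
Proof. by apply: (@addIr _ (dot 0 z)); rewrite -dotDl !add0r. Qed.

Lemma dotZl a x z : dot (a *: x) z = a * dot x z.
Proof. by have := ip_linear ip a x 0 z; rewrite dot0l !addr0. Qed.

Lemma dotNl x z : dot (- x) z = - dot x z.
Proof. by rewrite -scaleN1r dotZl mulN1r. Qed.

Lemma dotBl x y z : dot (x - y) z = dot x z - dot y z.
Proof. by rewrite dotDl dotNl. Qed.

Lemma dot_suml (I : Type) (F : seq I) (P : pred I) (f : I -> V) z :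
  dot (\sum_(i <- F | P i) f i) z = \sum_(i <- F | P i) dot (f i) z.
Proof.
by elim/big_rec2: _ => [|i y1 y2 _ <-]; rewrite ?dot0l ?dotDl.
Qed.

Lemma dotDr x y z : dot z (x + y) = dot z x + dot z y.
Proof. by rewrite (ip_conj ip) dotDl rmorphD /= -!(ip_conj ip). Qed.

Lemma dot0r z : dot z 0 = 0.
Proof. by rewrite (ip_conj ip) dot0l conjc0. Qed.

Lemma dotZr a x z : dot z (a *: x) = a^*%C * dot z x.
Proof. by rewrite (ip_conj ip) dotZl rmorphM /= -!(ip_conj ip). Qed.

Lemma dot_sumr (I : Type) (F : seq I) (P : pred I) (f : I -> V) z :
  dot z (\sum_(i <- F | P i) f i) = \sum_(i <- F | P i) dot z (f i).
Proof.
by elim/big_rec2: _ => [|i y1 y2 _ <-]; rewrite ?dot0r ?dotDr.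
Qed.

Lemma hnorm_ge0 x : 0 <= N x.
Proof. exact: sqrtr_ge0. Qed.

Lemma Re_dot_ge0 x : 0 <= Re (dot x x).
Proof. by have := ip_ge0 ip x; rewrite lecE => /andP[]. Qed.

Lemma hnorm_sqr x : N x ^+ 2 = Re (dot x x).
Proof. by rewrite /hnorm sqr_sqrtr ?Re_dot_ge0. Qed.

Lemma dot_hnorm x : dot x x = (N x ^+ 2)%:C%C.
Proof.
rewrite hnorm_sqr; have := ip_ge0 ip x; rewrite lecE => /andP[/eqP + _].
by case: (dot x x) => a b /= ->.
Qed.

Lemma hnorm0 : N 0 = 0.
Proof. by rewrite /hnorm dot0l sqrtr0. Qed.

Lemma hnorm_eq0 x : N x = 0 -> x = 0.
Proof.
by move=> x0; apply: (ip_eq0 ip); rewrite dot_hnorm x0 expr0n.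
Qed.

Lemma hnorm_sqZ a x : N (a *: x) ^+ 2 = normc a ^+ 2 * N x ^+ 2.
Proof.
apply: complexI; rewrite -dot_hnorm dotZl dotZr rmorphM/= normc_sqr dot_hnorm.
by rewrite mulrA.
Qed.

Lemma hnormZ a x : N (a *: x) = normc a * N x.
Proof.
apply/eqP; rewrite -(eqrXn2 (n := 2)) ?hnorm_ge0 ?mulr_ge0 ?normc_ge0 ?hnorm_ge0//.
by rewrite hnorm_sqZ exprMn.
Qed.

Lemma hnormN x : N (- x) = N x.
Proof. by rewrite -scaleN1r hnormZ normcN normc1 mul1r. Qed.

Lemma pythagoras x y : dot x y = 0 -> N (x + y) ^+ 2 = N x ^+ 2 + N y ^+ 2.
Proof.
move=> xy; rewrite !hnorm_sqr dotDl !dotDr xy (ip_conj ip x y) xy conjc0.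
by rewrite addr0 add0r; case: (dot x x) (dot y y) => [? ?] [? ?].
Qed.

(** The projection [p] of [x] on the line of [y] has length |(x, y)| / |y| and, by Pythagoras, is no
    longer than [x]. *)
Lemma cauchy_schwarz x y : normc (dot x y) <= N x * N y.
Proof.
have [y0|yn0] := eqVneq (N y) 0.
  by rewrite (hnorm_eq0 y0) dot0r normc0 hnorm0 mulr0.
have yy0 : dot y y != 0.
  by rewrite dot_hnorm; apply: contra_neq yn0 => -[/eqP]; rewrite sqrf_eq0 => /eqP.
pose p := (dot x y / dot y y) *: y.
have xp : dot (x - p) p = 0.
  by rewrite /p dotZr dotBl dotZl divfK// subrr mulr0.
have := pythagoras xp; rewrite subrK => h.
have {}h : N p ^+ 2 <= N x ^+ 2 by rewrite h lerDr sqr_ge0.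
rewrite -(ler_pXn2r (n := 2)) ?nnegrE ?mulr_ge0 ?normc_ge0 ?hnorm_ge0//.
rewrite exprMn -ler_pdivrMr ?exprn_gt0 ?lt0r ?yn0 ?hnorm_ge0//.
apply: le_trans h; rewrite /p hnorm_sqZ normcM normcV dot_hnorm normc_real.
rewrite (ger0_norm (sqr_ge0 (N y))).
by rewrite [leRHS](_ : _ = normc (dot x y) ^+ 2 / N y ^+ 2)//; field.
Qed.

Lemma hnormD x y : N (x + y) <= N x + N y.
Proof.
rewrite -(ler_pXn2r (n := 2)) ?nnegrE ?addr_ge0 ?hnorm_ge0//.
rewrite hnorm_sqr dotDl !dotDr (ip_conj ip x y) sqrrD !hnorm_sqr.
have := le_trans (Re_le_normc _) (cauchy_schwarz x y).
move=> /(le_trans (ler_norm _)).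
case: (dot x y) (dot x x) (dot y y) => [a b] [c f] [g h] /=; lra.
Qed.

Lemma hnormB x y : N (x - y) <= N x + N y.
Proof. by rewrite (le_trans (hnormD _ _)) ?hnormN. Qed.

Lemma hnorm_sum (I : Type) (F : seq I) (P : pred I) (f : I -> V) :
  N (\sum_(i <- F | P i) f i) <= \sum_(i <- F | P i) N (f i).
Proof.
elim/big_rec2: _ => [|i y1 y2 _ h]; first by rewrite hnorm0.
by rewrite (le_trans (hnormD _ _)) ?lerD2l.
Qed.

End inner_product_theory.

Section orthonormal_family.
Context {R : realType} {V : lmodType R[i]} (dot : V -> V -> R[i]).
Hypothesis ip : inner_product dot.
Context {I : eqType} (D : set I) (w : I -> V).
Hypothesis ow : orthonormal dot D w.
Local Notation N := (hnorm dot).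
Implicit Types F : seq I.

Definition ortho_proj F x := \sum_(i <- F) dot x (w i) *: w i.

Lemma dot_comb F (c : I -> R[i]) j : uniq F -> {in F, forall i, D i} -> D j ->
  dot (\sum_(i <- F) c i *: w i) (w j) = if j \in F then c j else 0.
Proof.
move=> uF FD Dj; rewrite (dot_suml ip).
under eq_big_seq => i iF.
  rewrite (dotZl ip) (ow (FD _ iF) Dj) mulr_natr mulrb; over.
rewrite -big_mkcond/=; case: ifPn => jF; last first.
  rewrite big_seq_cond big1// => i /andP[iF /eqP ij].
  by rewrite -ij iF in jF.
by rewrite -big_filter filter_pred1_uniq// big_seq1.
Qed.

Lemma dot_comb_comb F (c e : I -> R[i]) : uniq F -> {in F, forall i, D i} ->
  dot (\sum_(i <- F) c i *: w i) (\sum_(i <- F) e i *: w i) =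
  \sum_(i <- F) c i * (e i)^*%C.
Proof.
move=> uF FD; rewrite (dot_sumr ip); apply: eq_big_seq => i iF.
by rewrite (dotZr ip) (dot_comb _ uF FD (FD _ iF)) iF mulrC.
Qed.

Lemma hnorm_comb F (c : I -> R[i]) : uniq F -> {in F, forall i, D i} ->
  N (\sum_(i <- F) c i *: w i) ^+ 2 = \sum_(i <- F) normc (c i) ^+ 2.
Proof.
move=> uF FD; apply: complexI; rewrite -(dot_hnorm ip) dot_comb_comb//.
rewrite [RHS](raddf_sum (real_complex R)).
by apply: eq_bigr => i _; rewrite /= normc_sqr.
Qed.

Lemma ortho_proj_sub F x i : uniq F -> {in F, forall i, D i} -> i \in F ->
  dot (x - ortho_proj F x) (w i) = 0.
Proof.
move=> uF FD iF; rewrite (dotBl ip) /ortho_proj.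
by rewrite (dot_comb (fun i => dot x (w i)) uF FD (FD _ iF)) iF subrr.
Qed.

(** The two approximants differ by a combination of the family over [F], to which
    [x - ortho_proj F x] is orthogonal; Pythagoras concludes. *)
Lemma ortho_proj_best F x (c : I -> R[i]) : uniq F -> {in F, forall i, D i} ->
  N (x - ortho_proj F x) <= N (x - \sum_(i <- F) c i *: w i).
Proof.
move=> uF FD.
rewrite -(ler_pXn2r (n := 2)) ?nnegrE ?hnorm_ge0//.
rewrite -[X in _ <= N (X - _) ^+ 2](subrK (ortho_proj F x)) -[X in _ <= N X ^+ 2]addrA.
rewrite [leRHS](pythagoras ip); first by rewrite lerDl sqr_ge0.
rewrite /ortho_proj -sumrB (dot_sumr ip) big_seq big1// => i iF.
by rewrite -scalerBl (dotZr ip) ortho_proj_sub// mulr0.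
Qed.

Lemma ortho_proj_eq F x : uniq F -> {in F, forall i, D i} ->
  N (x - ortho_proj F x) ^+ 2 = N x ^+ 2 - \sum_(i <- F) normc (dot x (w i)) ^+ 2.
Proof.
move=> uF FD; apply/eqP; rewrite eq_sym subr_eq eq_sym; apply/eqP.
rewrite -(hnorm_comb (fun i => dot x (w i)))// -(pythagoras ip) ?subrK//.
rewrite (dot_sumr ip) big_seq big1// => i iF.
by rewrite (dotZr ip) ortho_proj_sub// mulr0.
Qed.

Lemma bessel F x : uniq F -> {in F, forall i, D i} ->
  \sum_(i <- F) normc (dot x (w i)) ^+ 2 <= N x ^+ 2.
Proof.
by move=> uF FD; rewrite -subr_ge0 -ortho_proj_eq// sqr_ge0.
Qed.

Lemma bessel1 x i : D i -> normc (dot x (w i)) <= N x.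
Proof.
move=> Di; rewrite (le_trans (cauchy_schwarz ip _ _))//.
by rewrite /hnorm ow// eqxx sqrtr1 mulr1.
Qed.

(** Cauchy-Schwarz for the two combinations whose coefficients are the moduli of those of [x] and
    [y]: their norms are bounded by Bessel, and their inner product is the left-hand side. *)
Lemma bessel2 F x y : uniq F -> {in F, forall i, D i} ->
  \sum_(i <- F) normc (dot x (w i)) * normc (dot y (w i)) <= N x * N y.
Proof.
move=> uF FD.
pose c z i := (normc (dot z (w i)))%:C%C : R[i].
have := cauchy_schwarz ip (\sum_(i <- F) c x i *: w i) (\sum_(i <- F) c y i *: w i).
rewrite dot_comb_comb// /c.
under eq_bigr do rewrite conjc_real -rmorphM/=.
rewrite -rmorph_sum normc_real ger0_norm; last first.
  by apply: sumr_ge0 => i _; rewrite mulr_ge0 ?normc_ge0.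
move=> /le_trans; apply; rewrite ler_pM ?hnorm_ge0//.
  rewrite -(ler_pXn2r (n := 2)) ?nnegrE ?hnorm_ge0// hnorm_comb//.
  under eq_bigr do rewrite normc_real ger0_norm ?normc_ge0//.
  exact: bessel.
rewrite -(ler_pXn2r (n := 2)) ?nnegrE ?hnorm_ge0// hnorm_comb//.
under eq_bigr do rewrite normc_real ger0_norm ?normc_ge0//.
exact: bessel.
Qed.

Hypothesis tw : total dot D w.

(** Totality provides one good approximation; projections being best approximations, every finite
    set containing its indices does at least as well. *)
Lemma total_proj x (eps : R) : 0 < eps -> exists2 F0 : seq I,
  uniq F0 /\ {in F0, forall i, D i} &
  forall F, uniq F -> {in F, forall i, D i} -> {subset F0 <= F} ->
    N (x - ortho_proj F x) < eps.
Proof.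
move=> /(tw x)[F0 [c [F0D F0x]]]; exists (undup F0).
  by split; [exact: undup_uniq | move=> i; rewrite mem_undup; exact: F0D].
move=> F uF FD F0F; apply: le_lt_trans F0x.
(* [F0] may have repetitions. *)
pose c' i : R[i] := (count_mem i F0)%:R * c i.
rewrite [X in _ <= N (x - X)](_ : _ = \sum_(i <- F) c' i *: w i); last first.
  rewrite [RHS](bigID [in F0])/= [X in _ = _ + X]big1 ?addr0; last first.
    by move=> i /count_memPn iF0; rewrite /c' iF0 mul0r scale0r.
  rewrite -[RHS]big_filter -[LHS]big_undup_iterop_count/=.
  have : perm_eq (undup F0) [seq i <- F | i \in F0].
    apply: uniq_perm; rewrite ?undup_uniq ?filter_uniq// => i.
    rewrite mem_undup mem_filter; case: (boolP (i \in F0)) => //= iF0.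
    by rewrite F0F// mem_undup.
  move=> pF; rewrite (perm_big _ pF); apply: eq_bigr => i _; rewrite /c'.
  rewrite -scalerA scaler_nat.
  by rewrite Monoid.iteropE; elim: (count_mem i F0) => //= n ->; rewrite mulrS.
exact: ortho_proj_best.
Qed.

Lemma total_eq0 x : (forall i, D i -> dot x (w i) = 0) -> x = 0.
Proof.
move=> xw; apply: (hnorm_eq0 ip); apply/eqP; rewrite eq_le hnorm_ge0 andbT.
apply/ler_addgt0Pr => e e0; have [F [uF FD] /(_ F)] := total_proj x e0.
rewrite add0r /ortho_proj big_seq big1 ?subr0.
  by move=> /(_ uF FD (fun _ => id))/ltW.
by move=> i iF; rewrite xw ?scale0r//; exact: FD.
Qed.

Lemma total_inj x y : (forall i, D i -> dot x (w i) = dot y (w i)) -> x = y.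
Proof.
move=> xy; apply/eqP; rewrite -subr_eq0; apply/eqP/total_eq0 => i Di.
by rewrite (dotBl ip) xy ?subrr.
Qed.

End orthonormal_family.

(** * Operators [T] such that [T^* T] is diagonal *)

Section esum_lemmas.
Context {R : realType}.

Lemma esum_seq_le (I : choiceType) (B : set I) (a : I -> \bar R) (F : seq I) :
  uniq F -> {in F, forall i, B i} ->
  (\sum_(i <- F) a i <= \esum_(i in B) a i)%E.
Proof.
move=> uF FB; apply: esum_ge; exists [set` F]; last by rewrite fsbig_seq.
by split; [exact: finite_seq | move=> i /= /FB].
Qed.

Lemma esum_infinite (I : choiceType) (B : set I) (c : R) :
  infinite_set B -> 0 < c -> (\esum_(i in B) c%:E)%E = +oo%E.
Proof.
move=> Binf c0; apply/eqyP => A A0.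
have [F FB Fn] := infinite_set_fset (Num.truncn (A / c)).+1 Binf.
have uF : uniq F by exact: fset_uniq.
apply: le_trans (esum_seq_le (fun=> c%:E) uF FB).
rewrite sumEFin lee_fin big_const_seq count_predT iter_addr_0.
rewrite -mulr_natr mulrC -ler_pdivrMr//.
apply: (@le_trans _ _ (Num.truncn (A / c)).+1%:R); last by rewrite ler_nat.
by rewrite ltW// truncnS_gt.
Qed.

(** Used to replace a multiplicity times [t ^ r] by a sum over the indices that carry the singular
    value [t]. *)
Lemma esum_cst (I : choiceType) (B : set I) (c : R) : 0 < c ->
  (\esum_(i in B) c%:E = (\esum_(i in B) 1) * c%:E)%E.
Proof.
move=> c0; have [Bfin|Binf] := pselect (finite_set B); last first.
  by rewrite !esum_infinite ?ltr01// gt0_mulye ?lte_fin.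
rewrite !esum_fset//; last by move=> i _; rewrite lee_fin ltW.
rewrite !fsbig_finite//= !sumEFin -EFinM; congr EFin.
by rewrite mulr_suml; under [RHS]eq_bigr do rewrite mul1r.
Qed.

Lemma esum_ord n (a : 'I_n -> \bar R) : (forall i, 0 <= a i)%E ->
  (\esum_(i in setT) a i = \sum_(i < n) a i)%E.
Proof.
move=> a0; rewrite esum_fset//; last exact: finite_finset.
rewrite (_ : [set: _] = [set` enum 'I_n]).
  by rewrite -fsbig_seq ?enum_uniq// big_enum.
by apply/seteqP; split => // i _ /=; rewrite mem_enum.
Qed.

Lemma esum_sigT (d : nat -> nat) (a : {l & 'I_(d l)} -> \bar R) :
  (forall i, 0 <= a i)%E ->
  (\esum_(i in setT) a i =
   \sum_(0 <= l <oo) \sum_(m < d l) a (Tagged (fun l => 'I_(d l)) m))%E.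
Proof.
move=> a0.
pose J (k : nat) : set {l & 'I_(d l)} := [set i | tag i = k].
have -> : [set: {l & 'I_(d l)}] = \bigcup_k J k.
  by apply/seteqP; split => // i _; exists (tag i).
rewrite nneseries_sum_bigcup//; last first.
  apply/trivIsetP => i j _ _ /eqP ij; apply/seteqP; split => // x [xi xj].
  by apply: ij; rewrite -xi -xj.
apply: eq_eseriesr => l _.
rewrite (@reindex_esum _ _ _ setT _ (fun m : 'I_(d l) => Tagged (fun l => 'I_(d l)) m)).
  exact: esum_ord.
split.
- by move=> m _.
- by move=> m m' _ _ /eqP; rewrite -tag_eqE /tag_eq/= eqxx tagged_asE => /eqP.
- by move=> [l' m] /= <-; exists m.
Qed.

End esum_lemmas.

(** * Bounds on the dimension of a set of vectors *)

Section vdim.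
Context {R : realType} {V : lmodType R[i]}.

(** If [m < k], the matrix of coordinates has a nonzero left kernel, and each of its rows is a
    vanishing combination of the [v i]. *)
Lemma lin_indep_size k m (v : 'I_k -> V) (u : 'I_m -> V) :
  lin_indep v -> (forall i, exists c : 'I_m -> R[i], v i = \sum_j c j *: u j) ->
  (k <= m)%N.
Proof.
move=> vi /choice[C Cv]; rewrite leqNgt; apply/negP => mk.
pose A : 'M[R[i]]_(k, m) := \matrix_(i, j) C i j.
have : (kermx A != 0).
  rewrite -mxrank_eq0 mxrank_ker -lt0n subn_gt0.
  by rewrite (leq_ltn_trans (rank_leq_col A)).
move=> /eqP; apply; apply/row_matrixP => p; rewrite row0.
have := mulmx_ker A => /(congr1 (row p)); rewrite row_mul row0 => pA.
apply/rowP => i; rewrite [RHS]mxE; apply: (vi (fun i => (row p (kermx A)) 0 i)).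
under eq_bigr do rewrite Cv scaler_sumr.
rewrite exchange_big big1//= => j _.
under eq_bigr do rewrite scalerA.
rewrite -scaler_suml; have /rowP/(_ j) := pA; rewrite !mxE => pj.
rewrite [X in X *: _](_ : _ = 0) ?scale0r// -[RHS]pj.
by apply: eq_bigr => i' _; rewrite !mxE.
Qed.

Lemma vdim_ge (S : set V) k (v : 'I_k -> V) : (forall i, S (v i)) ->
  lin_indep v -> (k%:R%:E <= vdim S)%E.
Proof. by move=> Sv vi; apply: ereal_sup_ubound; exists k => //; exists v. Qed.

Lemma vdim_le (S : set V) m (u : 'I_m -> V) :
  (forall x, S x -> exists c : 'I_m -> R[i], x = \sum_j c j *: u j) ->
  (vdim S <= m%:R%:E)%E.
Proof.
move=> Su; apply: ge_ereal_sup => _ [k [v [Sv vi]] <-].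
by rewrite lee_fin ler_nat (lin_indep_size (u := u) vi)// => i; exact: Su.
Qed.

End vdim.

(** * Singular values of an operator with T^* T diagonal *)

Section diagonal_operator.
Context {R : realType} {V : lmodType R[i]} (dot : V -> V -> R[i]).
Hypothesis ip : inner_product dot.
Context {I : choiceType} (w : I -> V).
Hypothesis ow : orthonormal dot setT w.
Hypothesis tw : total dot setT w.
Context (T : {linear V -> V}) (s : I -> R).
Hypothesis bT : bounded_operator dot T.
Hypothesis s_ge0 : forall i, 0 <= s i.
Hypothesis Ts : forall x i, dot (T x) (T (w i)) = (s i ^+ 2)%:C%C * dot x (w i).
Local Notation N := (hnorm dot).

Lemma bounded_ge0 : exists2 c : R, 0 <= c & forall x, N (T x) <= c * N x.
Proof.
have [c cT] := bT; exists `|c| => // x.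
by rewrite (le_trans (cT x))// ler_wpM2r ?hnorm_ge0// ler_norm.
Qed.

Lemma hnorm_image i : N (T (w i)) = s i.
Proof.
apply/eqP; rewrite -(eqrXn2 (n := 2)) ?hnorm_ge0//; apply/eqP.
by apply: complexI; rewrite -(dot_hnorm ip) Ts ow// eqxx mulr1.
Qed.

Lemma hnorm_image_comb (F : seq I) (c : I -> R[i]) : uniq F ->
  N (T (\sum_(i <- F) c i *: w i)) ^+ 2 =
  \sum_(i <- F) s i ^+ 2 * normc (c i) ^+ 2.
Proof.
move=> uF; apply: complexI; rewrite -(dot_hnorm ip).
rewrite {2}linear_sum (dot_sumr ip) [RHS](raddf_sum (real_complex R)).
apply: eq_big_seq => i iF; rewrite linearZ (dotZr ip) Ts.
rewrite (dot_comb ip ow)// iF [RHS]real_complexM.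
by rewrite normc_sqr mulrCA [_^*%C * _]mulrC.
Qed.

(** On finite combinations [T] multiplies the squared modulus of the coefficient [i] by [s i ^ 2],
    so the bound holds for the projections of [y]; boundedness of [T] absorbs the remainder. *)
Lemma diagonal_bound y (e : R) : 0 <= e ->
  (forall i, dot y (w i) != 0 -> s i <= e) -> N (T y) <= e * N y.
Proof.
move=> e0 ye; have [c c0 cT] := bounded_ge0.
apply/ler_addgt0Pr => t t0.
(* A remainder of this size has an image of norm at most [t]; the [+ 1] covers [c = 0]. *)
have t1 : 0 < t / (c + 1) by rewrite divr_gt0// ltr_wpDl.
have [F [uF FD] /(_ F uF FD (fun _ => id)) yF] := total_proj ip ow tw y t1.
rewrite -[X in T X](subrK (ortho_proj dot w F y)) linearD addrC.
rewrite (le_trans (hnormD ip _ _))// lerD//; last first.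
  rewrite (le_trans (cT _))// (@le_trans _ _ (c * (t / (c + 1))))//.
    by rewrite ler_wpM2l// ltW.
  by rewrite mulrCA ger_pMr// ler_pdivrMr ?mul1r ?lerDl// ltr_wpDl.
rewrite -(ler_pXn2r (n := 2)) ?nnegrE ?mulr_ge0 ?hnorm_ge0//.
rewrite /ortho_proj (hnorm_image_comb (fun i => dot y (w i)))// exprMn.
apply: le_trans (ler_wpM2l (sqr_ge0 _) (bessel ip ow y uF FD)).
rewrite mulr_sumr ler_sum// => i _.
have [->|yi] := eqVneq (dot y (w i)) 0; first by rewrite normc0 expr0n/= !mulr0.
by rewrite ler_wpM2r ?sqr_ge0// ler_pXn2r ?nnegrE// ye.
Qed.

Lemma singular_space_image i : singular_space dot T (s i) (w i).
Proof. by move=> x; rewrite Ts (dotZr ip) conjc_real. Qed.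

(** Computing (T w_i, T x) from either side gives s_i^2 (w_i, x) = t^2 (w_i, x), and distinct
    nonnegative numbers have distinct squares. *)
Lemma singular_space_dot t x i : singular_space dot T t x -> 0 <= t ->
  s i != t -> dot x (w i) = 0.
Proof.
move=> /(_ (w i)) + t0 st; rewrite (dotZr ip) conjc_real.
rewrite (ip_conj ip (T x)) Ts (ip_conj ip x (w i)) conjcM conjc_real => /eqP.
rewrite -subr_eq0 -mulrBl -rmorphB mulf_eq0 conjc_eq0 => /orP[|/eqP//].
rewrite -[X in _ == X]/((real_complex R) 0) => /eqP/complexI/eqP.
rewrite subr_eq0 eqrXn2//.
by rewrite (negbTE st).
Qed.

Lemma orthonormal_lin_indep k (f : 'I_k -> I) : injective f ->
  lin_indep (fun i => w (f i)).
Proof.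
move=> fi c c0 i.
have : dot (\sum_i c i *: w (f i)) (w (f i)) = c i.
  rewrite (dot_suml ip) (bigD1 i)//= (dotZl ip) ow// eqxx mulr1 big1 ?addr0//.
  by move=> j ji; rewrite (dotZl ip) ow// (inj_eq fi) (negbTE ji) mulr0.
by rewrite c0 (dot0l ip).
Qed.

(** The [w i] with [s i = t] lie in the space and are independent, which settles the case of
    infinitely many of them. If they are finitely many they span it, because a vector of the space
    has zero coefficient at every other index. *)
Lemma vdim_singular_space (t : R) : 0 < t ->
  vdim (singular_space dot T t) = (\esum_(i in [set i | s i = t]) 1)%E.
Proof.
move=> t0; set B := [set i | s i = t].
have lbd (F : {fset I}) : [set` F] `<=` B ->
    ((#|` F|)%:R%:E <= vdim (singular_space dot T t))%E.
  move=> FB; pose f (i : 'I_(#|` F|)) := tnth (in_tuple F) i.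
  apply: (@vdim_ge _ _ _ _ (fun i => w (f i))).
    move=> i; rewrite -(_ : s (f i) = t); first exact: singular_space_image.
    by apply: FB; exact: mem_tnth.
  apply: orthonormal_lin_indep => i j /eqP; rewrite /f !(tnth_nth (f i))/=.
  by rewrite nth_uniq ?fset_uniq// => /eqP/val_inj.
have [Bfin|Binf] := pselect (finite_set B); last first.
  rewrite esum_infinite//; apply/eqyP => A A0.
  have [F FB Fn] := infinite_set_fset (Num.truncn A).+1 Binf.
  apply: le_trans (lbd F FB); rewrite lee_fin.
  apply: (@le_trans _ _ (Num.truncn A).+1%:R); last by rewrite ler_nat.
  by rewrite ltW// truncnS_gt.
rewrite esum_fset// fsbig_finite//= sumEFin big_const_seq count_predT iter_addr_0.
apply/eqP; rewrite eq_le; apply/andP; split; last first.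
  by apply: lbd; rewrite fset_setK.
set F := fset_set B.
apply: (@vdim_le _ _ _ _ (fun i => w (tnth (in_tuple F) i))) => x xt.
exists (fun i => dot x (w (tnth (in_tuple F) i))).
rewrite -(big_tnth _ _ F predT (fun i => dot x (w i) *: w i)).
apply: (total_inj ip ow tw) => i _.
rewrite (dot_comb ip ow (fun i => dot x (w i)))//.
case: ifPn => //; rewrite in_fset_set// notin_setE => iB.
apply: (singular_space_dot xt); first exact: ltW.
exact/eqP.
Qed.

(** The double sum runs over the pairs (t, i) with s_i = t > 0, which [i] parametrises by (s_i, i).
    The indices with s_i = 0 may be added since 0 ^ r = 0 for r > 0. *)
Lemma esum_singular_values (r : R) : 0 < r ->
  (\esum_(t in [set t : R | (0 < t)%R])
     vdim (singular_space dot T t) * (t `^ r)%:E =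
   \esum_(i in setT) (s i `^ r)%:E)%E.
Proof.
move=> r0.
transitivity (\esum_(t in [set t : R | (0 < t)%R])
    \esum_(i in [set i | s i = t]) (s i `^ r)%:E)%E.
  apply: eq_esum => t /= t0; rewrite vdim_singular_space//.
  rewrite -esum_cst ?powR_gt0//; apply: eq_esum => i /= ->.
  by [].
rewrite esum_esum; last by move=> *; rewrite lee_fin powR_ge0.
rewrite (@reindex_esum _ _ _ [set i | 0 < s i] _ (fun i => (s i, i))); last first.
  split.
  - by move=> i /= si.
  - by move=> i j _ _ [].
  - by move=> [t i] [/= t0 it]; exists i; rewrite /= it.
rewrite esum_mkcond; apply: eq_esum => i _ /=; case: ifPn => // /negP iN.
have si : ~ (0 < s i) by move=> si; apply: iN; exact/mem_set.
have -> : s i = 0 by apply/eqP; rewrite eq_le s_ge0 andbT leNgt; apply/negP.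
by rewrite powR0// gt_eqF.
Qed.

(** Infinitely many terms at least [e ^ r] would have an infinite sum. *)
Lemma summable_finite_gt (r e : R) : 0 < r -> 0 < e ->
  (\esum_(i in setT) (s i `^ r)%:E < +oo)%E -> finite_set [set i | e < s i].
Proof.
move=> r0 e0 sfin; apply: contrapT => Binf.
suff : (\esum_(i in setT) (s i `^ r)%:E)%E = +oo%E by move=> h; rewrite h in sfin.
have := @esum_infinite R _ _ (e `^ r) Binf (powR_gt0 _ e0) => h.
apply/eqP; rewrite -leye_eq -h esum_mkcond le_esum// => i _.
case: ifPn; last by rewrite lee_fin powR_ge0.
move=> /set_mem/ltW ei; rewrite lee_fin ge0_ler_powR// ?nnegrE ?s_ge0// ltW//.
Qed.

End diagonal_operator.

(** * Compactness when only finitely many s_i exceed any given positive number *)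

Section compact_diagonal.
Context {R : realType} {V : lmodType R[i]} (dot : V -> V -> R[i]).
Hypothesis ip : inner_product dot.
Hypothesis cV : hcomplete dot.
Context {I : choiceType} (w : I -> V).
Hypothesis ow : orthonormal dot setT w.
Hypothesis tw : total dot setT w.
Context (T : {linear V -> V}) (s : I -> R).
Hypothesis bT : bounded_operator dot T.
Hypothesis s_ge0 : forall i, 0 <= s i.
Hypothesis Ts : forall x i, dot (T x) (T (w i)) = (s i ^+ 2)%:C%C * dot x (w i).
Hypothesis finite_gt : forall e : R, 0 < e -> finite_set [set i | e < s i].
Local Notation N := (hnorm dot).

(* Working along an ultrafilter that contains the tails of [nat] replaces the
   diagonal extraction of a subsequence: every bounded scalar sequence converges
   along it. *)
Section ultra.
Context (U : set_system nat) {UU : UltraFilter U}.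

(** By compactness of [-b, b] the values of [f] cluster at some [p] along [U]. The ultrafilter
    contains the preimage of a ball around [p] or its complement, and the latter would contradict
    clustering. *)
Lemma ultra_bounded_close (f : nat -> R) (b e : R) : (forall k, `|f k| <= b) ->
  0 < e -> exists2 A, U A & forall k l, A k -> A l -> `|f k - f l| < e.
Proof.
move=> fb e0.
have [p [_ fp]] : [set` `[-b, b]] `&` cluster (f @ U) !=set0.
  apply: (@segment_compact _ (- b) b (f @ U)).
  apply: (@filterS _ U _ setT); last exact: filterT.
  by move=> k _ /=; rewrite in_itv/= -ler_norml.
have e20 : 0 < e / 2 by rewrite divr_gt0.
have UA : U (f @^-1` (ball p (e / 2))).
  have [//|nU] := in_ultra_setVsetC (f @^-1` (ball p (e / 2))) UU.
  have fU : (f @ U) (~` ball p (e / 2)) by [].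
  by have [x []] := fp _ _ fU (nbhsx_ballx p _ e20).
exists (f @^-1` ball p (e / 2)) => // k l.
rewrite /= -!ball_normE/= => pk pl.
have := ler_distD p (f k) (f l).
by move=> /le_lt_trans; apply; rewrite (splitr e) distrC ltrD// distrC.
Qed.

Context (u : nat -> V) (c : R).
Hypothesis uc : forall k, N (u k) <= c.

Lemma ultra_coef_close (F : seq I) (e : R) : 0 < e ->
  exists2 A, U A & forall k l, A k -> A l ->
    \sum_(i <- F) normc (dot (u k - u l) (w i)) < e.
Proof.
elim: F e => [|i F ih] e e0.
  by exists setT; [exact: filterT | move=> k l _ _; rewrite big_nil].
have e20 : 0 < e / 2 by rewrite divr_gt0.
have e40 : 0 < e / 2 / 2 by rewrite divr_gt0.
have bnd k : normc (dot (u k) (w i)) <= c.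
  by rewrite (le_trans (bessel1 ip ow _ _)).
have [A UA Ae] := ih _ e20.
have [B UB Be] := ultra_bounded_close
  (fun k => le_trans (Re_le_normc _) (bnd k)) e40.
have [C UC Ce] := ultra_bounded_close
  (fun k => le_trans (Im_le_normc _) (bnd k)) e40.
exists (A `&` (B `&` C)); first by apply: filterI => //; exact: filterI.
move=> k l [Ak [Bk Ck]] [Al [Bl Cl]]; rewrite big_cons (splitr e).
rewrite ltrD ?Ae// (le_lt_trans (normc_le_ReIm _))// (splitr (e / 2)) (dotBl ip).
have := Be _ _ Bk Bl; have := Ce _ _ Ck Cl.
by case: (dot (u k) _) (dot (u l) _) => [? ?] [? ?] /= ? ?; rewrite ltrD.
Qed.

(** The difference [z] is split into its projection on the finitely many [w i] with [s i > e1],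
    whose coefficients are small along [U], and a remainder on which [T] contracts by the factor
    [e1]. *)
Lemma ultra_image_close (e : R) : 0 < e ->
  exists2 A, U A & forall k l, A k -> A l -> N (T (u k) - T (u l)) < e.
Proof.
move=> e0; have [C C0 CT] := bounded_ge0 bT.
have c0 : 0 <= c by rewrite (le_trans _ (uc 0)) ?hnorm_ge0.
have c1 : 0 < 4 * (c + 1) by rewrite mulr_gt0// ltr_wpDl.
(* Since |z| <= 2 c, the remainder contributes at most 2 c e1 < e / 2. *)
pose e1 := e / (4 * (c + 1)).
have e10 : 0 < e1 by rewrite divr_gt0.
have C1 : 0 < 2 * (C + 1) by rewrite mulr_gt0// ltr_wpDl.
pose F : seq I := fset_set [set i | e1 < s i].
have uF : uniq F by exact: fset_uniq.
(* With this bound on the coefficients, the image of the projection has norm at most C e / (2 (C +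
   1)) <= e / 2. *)
have [A UA Ae] := @ultra_coef_close F (e / (2 * (C + 1))) (divr_gt0 e0 C1).
exists A => // k l Ak Al; rewrite -linearB.
set z := u k - u l.
have Nz : N z <= 2 * c.
  by rewrite (le_trans (hnormB ip _ _))// mulr_natl mulr2n lerD.
rewrite -[X in T X](subrK (ortho_proj dot w F z)) linearD.
rewrite (le_lt_trans (hnormD ip _ _))// (splitr e) ltr_leD//.
  rewrite (@le_lt_trans _ _ (e1 * (2 * c)))//; last first.
    rewrite /e1 mulrAC ltr_pdivrMr// mulrAC ltr_pdivlMr//.
    rewrite -mulrA ltr_pM2l//; lra.
  apply: le_trans (ler_wpM2l (ltW e10) Nz).
  rewrite (@le_trans _ _ (e1 * N (z - ortho_proj dot w F z)))//.
    apply: (diagonal_bound ip ow tw bT s_ge0 Ts); first exact: ltW.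
    move=> i; rewrite leNgt; apply: contra => si; apply/eqP.
    apply: (ortho_proj_sub ip ow) => //.
    by rewrite in_fset_set; [exact/mem_set | exact: finite_gt].
  rewrite ler_wpM2l ?(ltW e10)//.
  rewrite -(ler_pXn2r (n := 2)) ?nnegrE ?hnorm_ge0//.
  rewrite (ortho_proj_eq ip ow)// gerBl; apply: sumr_ge0 => i _.
  exact: sqr_ge0.
rewrite (le_trans (CT _))// (@le_trans _ _ (C * (e / (2 * (C + 1)))))//.
  rewrite ler_wpM2l// (le_trans _ (ltW (Ae _ _ Ak Al)))//.
  rewrite (le_trans (hnorm_sum ip _ _ _))// ler_sum// => i _.
  by rewrite (hnormZ ip) /hnorm ow// eqxx sqrtr1 mulr1.
rewrite mulrA ler_pdivrMr// mulrAC ler_pdivlMr//.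
rewrite -mulrA mulrC -mulrA ler_pM2l//; lra.
Qed.

End ultra.

(** On a set [A m] of [U] the images are within 1 / (m + 1) of each other. The term [phi n] is taken
    in [A 0], ..., [A n] and beyond [phi (n - 1)], which is possible because [U] contains these
    intersections and the tails of [nat]. The images are then Cauchy, and completeness supplies the
    limit. *)
Lemma diagonal_compact : compact_operator dot T.
Proof.
move=> u [c uc].
have [U [UU ooU]] := ultraFilterLemma (_ : ProperFilter \oo).
have UP : ProperFilter U := ultra_proper.
pose e (n : nat) : R := n.+1%:R^-1.
have e0 n : 0 < e n by rewrite invr_gt0.
have /choice[A AP] n : exists A, U A /\
    forall k l, A k -> A l -> N (T (u k) - T (u l)) < e n.
  by have [A UA Ae] := ultra_image_close uc (e0 n); exists A.
have UB n : U [set l | forall m, (m <= n)%N -> A m l].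
  elim: n => [|n ih].
    by apply: filterS (proj1 (AP 0%N)) => l Al m; rewrite leqn0 => /eqP ->.
  apply: filterS (filterI ih (proj1 (AP n.+1))) => l [An Al] m.
  by rewrite leq_eqVlt => /orP[/eqP -> //|]; exact: An.
have /choice[g gP] (x : nat * nat) : exists l, (x.2 < l)%N /\
    (forall m, (m <= x.1)%N -> A m l).
  have : U ([set l | (x.2 < l)%N] `&` [set l | forall m, (m <= x.1)%N -> A m l]).
    by apply: filterI => //; apply: ooU; exact: nbhs_infty_gt.
  by move=> /filter_ex[l [xl Bl]]; exists l.
pose phi := fix phi n := if n is n'.+1 then g (n, phi n') else g (0%N, 0%N).
have phiA m n : (m <= n)%N -> A m (phi n).
  by case: n => [|n] mn; [have [_] := gP (0%N, 0%N) | have [_] := gP (n.+1, phi n)];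
    apply.
have [y yP] : exists y, (fun n => N (T (u (phi n)) - y)) @ \oo --> (0 : R).
  apply: (cV (u := fun n => T (u (phi n)))) => t t0.
  have [n nt] : exists n, e n < t.
    exists (Num.truncn t^-1).
    by rewrite /e invf_plt ?posrE// truncnS_gt.
  exists n => k l nk nl; apply: lt_trans nt.
  by have [_] := AP n; apply; exact: phiA.
exists phi, y; split => //.
by apply: homo_ltn; [exact: ltn_trans | move=> n /=; have [] := gP (n.+1, phi n)].
Qed.

End compact_diagonal.

(** * The trace *)

Section cauchy.
Context {R : realType}.

Lemma cvg_seqP (u : nat -> R) (l : R) : u @ \oo --> l <->
  (forall e, 0 < e -> exists n, forall k, (n <= k)%N -> `|u k - l| < e).
Proof.
split.
  move=> /cvgrPdist_lt ul e /ul[n _ un]; exists n => k nk.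
  by rewrite distrC; exact: un.
move=> ul; apply/cvgrPdist_lt => e /ul[n un]; exists n => // k /= nk.
by rewrite distrC un.
Qed.

Lemma cauchy_seq_cvg (u : nat -> R) :
  (forall e, 0 < e -> exists n, forall k l, (n <= k)%N -> (n <= l)%N ->
    `|u k - u l| < e) -> exists l : R, u @ \oo --> l.
Proof.
move=> uC; suff : cvg (u @ \oo) by exists (lim (u @ \oo)).
apply/cauchy_cvgP/cauchy_exP => e e0; have [n un] := uC e e0.
exists (u n); exists n => // k /= nk.
by rewrite -ball_normE/=; exact: un.
Qed.

Lemma cvgc_seqP (u : nat -> R[i]) (l : R[i]) : cvgc u l <->
  (forall e, 0 < e -> exists n, forall k, (n <= k)%N -> normc (u k - l) < e).
Proof.
split.
  move=> [/cvg_seqP uR /cvg_seqP uI] e e0.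
  have e20 : 0 < e / 2 by rewrite divr_gt0.
  have [n un] := uR _ e20; have [m um] := uI _ e20.
  exists (maxn n m) => k; rewrite geq_max => /andP[nk mk].
  rewrite (le_lt_trans (normc_le_ReIm _))// (splitr e).
  have := un _ nk; have := um _ mk; rewrite /=.
  by case: (u k) l {un um uR uI} => [? ?] [? ?] /= ? ?; rewrite ltrD.
move=> ul; split; apply/cvg_seqP => e /ul[n un]; exists n => k /un.
  apply: le_lt_trans; apply: le_trans (Re_le_normc _).
  by rewrite /=; case: (u k) l {ul un} => [? ?] [].
apply: le_lt_trans; apply: le_trans (Im_le_normc _).
by rewrite /=; case: (u k) l {ul un} => [? ?] [].
Qed.

Lemma cauchy_seq_cvgc (u : nat -> R[i]) :
  (forall e, 0 < e -> exists n, forall k l, (n <= k)%N -> (n <= l)%N ->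
    normc (u k - u l) < e) -> exists l, cvgc u l.
Proof.
move=> uC.
have [a ua] : exists a : R, (Re \o u) @ \oo --> a.
  apply: cauchy_seq_cvg => e /uC[n un]; exists n => k l nk nl.
  apply: le_lt_trans (un k l nk nl); apply: le_trans (Re_le_normc _).
  by rewrite /=; case: (u k) (u l) => [? ?] [].
have [b ub] : exists b : R, (Im \o u) @ \oo --> b.
  apply: cauchy_seq_cvg => e /uC[n un]; exists n => k l nk nl.
  apply: le_lt_trans (un k l nk nl); apply: le_trans (Im_le_normc _).
  by rewrite /=; case: (u k) (u l) => [? ?] [].
by exists (Complex a b).
Qed.

End cauchy.

Lemma big_uniq_subset {V : zmodType} {I : eqType} (A B : seq I) (f : I -> V) :
  uniq A -> uniq B -> {subset A <= B} ->
  \sum_(i <- B) f i = \sum_(i <- A) f i + \sum_(i <- B | i \notin A) f i.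
Proof.
move=> uA uB AB; rewrite (bigID [in A])/=; congr +%R.
rewrite -big_filter; apply: perm_big; apply: uniq_perm => //.
  exact: filter_uniq.
move=> i; rewrite mem_filter; case: (boolP (i \in A)) => //= /AB.
by [].
Qed.

(** * The trace is the same in every orthonormal basis *)

Section trace.
Context {R : realType} {V : lmodType R[i]} (dot : V -> V -> R[i]).
Hypothesis ip : inner_product dot.
Context {I : choiceType} (w : I -> V).
Hypothesis ow : orthonormal dot setT w.
Hypothesis tw : total dot setT w.
Context (T : {linear V -> V}).
Hypothesis bT : bounded_operator dot T.
(** An exhaustion by finite lists stands in for an enumeration of [I], so that partial traces can be
    taken one whole block at a time. *)
Context (F : nat -> seq I).
Hypothesis uF : forall n, uniq (F n).
Hypothesis F_mono : forall n m, (n <= m)%N -> {subset F n <= F m}.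
Hypothesis F_exh : forall i, exists n, i \in F n.
Local Notation N := (hnorm dot).

Lemma seq_exhaust (G : seq I) : exists n, {subset G <= F n}.
Proof.
elim: G => [|i G [n Gn]]; first by exists 0%N.
have [m im] := F_exh i; exists (maxn n m) => j; rewrite inE => /orP[/eqP ->|/Gn].
  exact: F_mono (leq_maxr _ _) _ im.
exact: F_mono (leq_maxl _ _) _.
Qed.

Lemma proj_cvg (x : V) (e : R) : 0 < e -> exists n, forall m, (n <= m)%N ->
  N (x - ortho_proj dot w (F m) x) < e.
Proof.
move=> /(total_proj ip ow tw x)[G _ Ge]; have [n Gn] := seq_exhaust G.
exists n => m nm; apply: Ge => // i /Gn; exact: F_mono.
Qed.

Context (B : R).
Hypothesis TB : forall n, \sum_(i <- F n) N (T (w i)) <= B.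

Let q n := \sum_(i <- F n) N (T (w i)).

Lemma tail_small (e : R) : 0 < e -> exists n0, forall n m, (n0 <= n <= m)%N ->
  \sum_(i <- F m | i \notin F n) N (T (w i)) < e.
Proof.
move=> e0.
have qE n m : (n <= m)%N -> q m = q n + \sum_(i <- F m | i \notin F n) N (T (w i)).
  by move=> nm; rewrite /q (big_uniq_subset _ (uF n) (uF m))//; exact: F_mono.
have qm : {homo q : n m / (n <= m)%N >-> n <= m}.
  move=> n m nm; rewrite (qE _ _ nm) lerDl; apply: sumr_ge0 => i _.
  exact: hnorm_ge0.
have qc : cvgn q.
  apply: nondecreasing_is_cvgn => //; exists B => _ [n _ <-]; exact: TB.
have [n qn] := (cvg_seqP _ _).1 qc e e0.
exists n => k m /andP[nk km]; have := nondecreasing_cvgn_le qm qc m.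
have := qn k nk; rewrite (qE _ _ km) ltr_norml => /andP[+ _].
by move: (lim _) (\sum_(_ <- _ | _) _) => l x; lra.
Qed.

Section other_basis.
Context (J : eqType) (D : set J) (phi : J -> V).
Hypothesis ophi : orthonormal dot D phi.

(* The bound does not depend on [G]; this uniformity lets one exchange the sum
   over [w] with the limit over the basis [phi]. *)
Lemma trace_block (K : seq I) (G : seq J) : uniq G -> {in G, forall j, D j} ->
  normc (\sum_(i <- K) \sum_(j <- G) dot (phi j) (w i) * dot (T (w i)) (phi j))
  <= \sum_(i <- K) N (T (w i)).
Proof.
move=> uG GD; rewrite (le_trans (normc_sum _ _ _))// ler_sum// => i _.
rewrite (le_trans (normc_sum _ _ _))//.
rewrite (@le_trans _ _ (N (w i) * N (T (w i))))//; last first.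
  by rewrite /hnorm ow// eqxx sqrtr1 mul1r.
apply: le_trans (bessel2 ip ophi (w i) (T (w i)) uG GD).
by apply: ler_sum => j _; rewrite normcM (ip_conj ip (w i)) normc_conj.
Qed.

(** Truncating the expansion of the [phi j] at a late [m] is accurate; going back from [m] to [n]
    costs, by [trace_block], at most a tail of the sum of the |T w_i|. Hence [n0] is chosen before
    [G]. *)
Lemma trace_truncate (e : R) : 0 < e -> exists n0, forall n (G : seq J),
  (n0 <= n)%N -> uniq G -> {in G, forall j, D j} ->
  normc (\sum_(j <- G) dot (T (phi j)) (phi j) -
   \sum_(i <- F n) \sum_(j <- G) dot (phi j) (w i) * dot (T (w i)) (phi j)) < e.
Proof.
move=> e0; have e20 : 0 < e / 2 by rewrite divr_gt0.
have [C C0 CT] := bounded_ge0 bT.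
have [n0 qn] := tail_small e20; exists n0 => n G n0n uG GD.
pose P m := \sum_(j <- G) N (phi j - ortho_proj dot w (F m) (phi j)).
(* This [m] may depend on [G]: only finitely many [phi j] have to be approximated by their
   projections on the span of [F m]. *)
have [m [nm mP]] : exists m, (n <= m)%N /\ C * P m < e / 2.
  have [m mP] : exists m, forall k, (m <= k)%N -> C * P k < e / 2.
    rewrite /P; elim: G {uG GD P} (e / 2) e20 => [|j G ih] t t0.
      by exists 0%N => k _; rewrite big_nil mulr0.
    have t20 : 0 < t / 2 by rewrite divr_gt0.
    have C1 : 0 < C + 1 by rewrite ltr_wpDl.
    have [m1 h1] := ih _ t20; have [m2 h2] := proj_cvg (phi j) (divr_gt0 t20 C1).
    exists (maxn m1 m2) => k; rewrite geq_max => /andP[k1 k2].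
    rewrite big_cons mulrDr (splitr t) ltr_leD//; last by rewrite ltW// h1.
    have := h2 _ k2; rewrite ltr_pdivlMr// => /(le_lt_trans _); apply.
    by rewrite mulrC ler_wpM2l ?hnorm_ge0// lerDl.
  by exists (maxn n m); split; [exact: leq_maxl | apply: mP; exact: leq_maxr].
pose Z := \sum_(i <- F m) \sum_(j <- G) dot (phi j) (w i) * dot (T (w i)) (phi j).
rewrite -(subrK Z (\sum_(j <- G) _)) -addrA (le_lt_trans (le_normcD _ _))//.
rewrite (splitr e) ltrD//.
  apply: le_lt_trans mP; rewrite /Z exchange_big/= -sumrB /P mulr_sumr.
  rewrite (le_trans (normc_sum _ _ _))// big_seq [leRHS]big_seq ler_sum// => j jG.
  rewrite (_ : _ - _ = dot (T (phi j - ortho_proj dot w (F m) (phi j))) (phi j)).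
    rewrite (le_trans (cauchy_schwarz ip _ _))//.
    by rewrite {2}/hnorm (ophi (GD _ jG) (GD _ jG)) eqxx sqrtr1 mulr1 CT.
  rewrite linearB (dotBl ip) /ortho_proj [X in _ = _ - dot X _]linear_sum.
  rewrite [X in _ = _ - X](dot_suml ip).
  by congr (_ - _); apply: eq_bigr => i _; rewrite linearZ (dotZl ip).
rewrite /Z (big_uniq_subset _ (uF n) (uF m)); last exact: F_mono.
rewrite addrAC subrr add0r -big_filter.
rewrite (le_lt_trans (trace_block _ uG GD))// big_filter.
by apply: qn; rewrite n0n.
Qed.

End other_basis.

(** For a fixed [i], the sum over [j] is the inner product with [w i] of the projection of [T (w i)]
    on the first vectors [phi j], and these projections tend to [T (w i)]. *)
Lemma trace_block_cvg (D : set nat) (phi : nat -> V) (K : seq I) (e : R) :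
  orthonormal dot D phi -> total dot D phi -> 0 < e ->
  exists k0, forall k, (k0 <= k)%N ->
  normc (\sum_(i <- K) \sum_(0 <= j < k | j \in D)
      dot (phi j) (w i) * dot (T (w i)) (phi j) -
    \sum_(i <- K) dot (T (w i)) (w i)) < e.
Proof.
move=> ophi tphi; elim: K e => [|i K ih] e e0.
  by exists 0%N => k _; rewrite !big_nil subrr normc0.
have e20 : 0 < e / 2 by rewrite divr_gt0.
have [k1 h1] := ih _ e20.
have [G [uG GD] GP] := total_proj ip ophi tphi (T (w i)) e20.
(* The upper bound of [index_iota 0 k] is excluded, hence [j.+1]. *)
exists (maxn k1 (\max_(j <- G) j.+1)) => k; rewrite geq_max => /andP[kk1 kG].
rewrite !big_cons opprD addrACA (le_lt_trans (le_normcD _ _))//.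
rewrite (splitr e) ltrD ?h1//.
set L := [seq j <- index_iota 0 k | j \in D].
have LD : {in L, forall j, D j} by move=> j; rewrite mem_filter => /andP[/set_mem].
have uL : uniq L by rewrite filter_uniq// iota_uniq.
have GL : {subset G <= L}.
  move=> j jG; rewrite mem_filter mem_index_iota (mem_set (GD _ jG))/=.
  by apply: leq_trans kG; rewrite (big_rem j jG)/= leq_max leqnn.
apply: le_lt_trans (GP L uL LD GL).
rewrite (_ : _ - _ = - dot (T (w i) - ortho_proj dot phi L (T (w i))) (w i)).
  rewrite normcN (le_trans (cauchy_schwarz ip _ _))//.
  by rewrite {2}/hnorm ow// eqxx sqrtr1 mulr1.
rewrite (dotBl ip) opprB /ortho_proj (dot_suml ip) big_filter.
by congr (_ - _); apply: eq_bigr => j _; rewrite (dotZl ip) mulrC.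
Qed.

(** The partial traces along [F] are Cauchy because |(T w_i, w_i)| <= |T w_i|; this defines [t]. In
    another basis there are three errors of [e / 3]: truncation to [F n], the limit over [phi] for
    this fixed [n], and the distance of the [n]-th partial trace to [t]. The first is uniform in
    [k], so [n] can be fixed before [k]. *)
Lemma trace_cvg : exists2 t, has_trace dot T t &
  cvgc (fun n => \sum_(i <- F n) dot (T (w i)) (w i)) t.
Proof.
have [t tP] : exists t, cvgc (fun n => \sum_(i <- F n) dot (T (w i)) (w i)) t.
  have step n m : (n <= m)%N -> normc (\sum_(i <- F m) dot (T (w i)) (w i) -
     \sum_(i <- F n) dot (T (w i)) (w i)) <=
     \sum_(i <- F m | i \notin F n) N (T (w i)).
    move=> nm; rewrite (big_uniq_subset _ (uF n) (uF m)); last exact: F_mono.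
    rewrite addrAC subrr add0r (le_trans (normc_sum _ _ _))// ler_sum// => i _.
    rewrite (le_trans (cauchy_schwarz ip _ _))//.
    by rewrite {2}/hnorm ow// eqxx sqrtr1 mulr1.
  apply: cauchy_seq_cvgc => e e0; have e20 : 0 < e / 2 by rewrite divr_gt0.
  have [n qn] := tail_small e20; exists n => k l nk nl.
  set c := \sum_(i <- F n) dot (T (w i)) (w i).
  rewrite -(subrK c (\sum_(i <- F k) _)) -addrA.
  rewrite (le_lt_trans (le_normcD _ _))// (splitr e) ltrD//.
    by rewrite (le_lt_trans (step _ _ nk))// qn// leqnn.
  by rewrite -normcN opprB (le_lt_trans (step _ _ nl))// qn// leqnn.
exists t => // D phi [ophi tphi].
have {}ophi : orthonormal dot D phi by [].
have tphi' : total dot D phi.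
  move=> x e /(tphi x)[K [c xK]].
  exists [seq i <- index_iota 0 K | i \in D], c; split.
    by move=> i; rewrite mem_filter => /andP[/set_mem].
  by rewrite big_filter.
apply/cvgc_seqP => e e0; have e30 : 0 < e / 3 by rewrite divr_gt0.
have [n0 tn] := (cvgc_seqP _ _).1 tP _ e30.
have [n1 hn1] := trace_truncate ophi e30.
pose n := maxn n0 n1.
have [k0 hk] := trace_block_cvg (F n) ophi tphi' e30.
exists k0 => k /hk hk'.
set L := [seq j <- index_iota 0 k | j \in D].
have LD : {in L, forall j, D j} by move=> j; rewrite mem_filter => /andP[/set_mem].
have uL : uniq L by rewrite filter_uniq// iota_uniq.
have := hn1 n L (leq_maxr _ _) uL LD; rewrite big_filter.
under [X in _ - X]eq_bigr do rewrite big_filter.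
have := tn n (leq_maxl _ _); move: hk'.
move: (\sum_(0 <= i < k | _) _) (\sum_(i <- F n) \sum_(j <- _ | _) _) => a b.
move: (\sum_(i <- F n) _) => c h1 h2 h3.
rewrite (_ : a - t = (a - b) + ((b - c) + (c - t))); last by ring.
apply: le_lt_trans (le_normcD _ _) _.
apply: le_lt_trans (lerD (lexx _) (le_normcD _ _)) _.
by lra.
Qed.

End trace.

(** * Matrices *)

Section column_vectors.
Context {R : realType} {d : nat}.
Implicit Types (x y : 'cV[R[i]]_d) (M : 'M[R[i]]_d).
Local Notation N := (hnorm (@cVdot R d)).

Lemma cVdot_inner_product : inner_product (@cVdot R d).
Proof.
split.
- move=> a x y z; rewrite /cVdot mulr_sumr -big_split/=.
  by apply: eq_bigr => i _; rewrite !mxE mulrDl mulrA.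
- move=> x y; rewrite /cVdot [RHS](raddf_sum (@conjc R)).
  by apply: eq_bigr => i _; rewrite /= conjcM conjcK mulrC.
- by move=> x; apply: sumr_ge0 => i _; exact: mulcJ_ge0.
- move=> x /eqP; rewrite psumr_eq0; last by move=> i _; exact: mulcJ_ge0.
  move=> /allP x0; apply/colP => i; rewrite mxE; apply/eqP.
  have := x0 i (mem_index_enum _); rewrite /= mulf_eq0 conjc_eq0.
  by rewrite orbb.
Qed.

Local Notation ip := cVdot_inner_product.

Lemma normc_le_hnorm x i : normc (x i 0) <= N x.
Proof.
rewrite -(ler_pXn2r (n := 2)) ?nnegrE ?normc_ge0 ?hnorm_ge0//.
rewrite (hnorm_sqr ip) /cVdot Re_sum (bigD1 i)//= -normc_sqr lerDl.
by apply: sumr_ge0 => j _; rewrite -normc_sqr sqr_ge0.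
Qed.

Lemma hnorm_le_sum x : N x <= \sum_i normc (x i 0).
Proof.
rewrite [X in N X](_ : x = \sum_i x i 0 *: delta_mx i 0); last first.
  by rewrite [LHS]matrix_sum_delta; apply: eq_bigr => i _; rewrite big_ord1.
rewrite (le_trans (hnorm_sum ip _ _ _))// ler_sum// => i _.
rewrite (hnormZ ip) /hnorm /cVdot (bigD1 i)//= big1 ?addr0.
  by rewrite mxE !eqxx/= mulr1 oppr0 mulr0 subr0 sqrtr1 mulr1.
by move=> j ji; rewrite mxE (negbTE ji) mul0r.
Qed.

Lemma cVdot_complete : hcomplete (@cVdot R d).
Proof.
move=> u uC.
have /choice[y yP] (i : 'I_d) : exists l, cvgc (fun n => u n i 0) l.
  apply: cauchy_seq_cvgc => e /uC[n un]; exists n => k l nk nl.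
  have := normc_le_hnorm (u k - u l) i; rewrite !mxE => /le_lt_trans; apply.
  exact: un.
exists (\col_i y i); apply/cvg_seqP => e e0.
(* With [d.+1] instead of [d], the case [d = 0] is covered and the sum of [d] such terms is strictly
   below [e]. *)
have e10 : 0 < e / d.+1%:R by rewrite divr_gt0.
have /choice[m mP] (i : 'I_d) := (cvgc_seqP _ _).1 (yP i) _ e10.
exists (\max_i m i) => k mk; rewrite subr0 ger0_norm ?hnorm_ge0//.
apply: le_lt_trans (hnorm_le_sum _) _.
apply: (@le_lt_trans _ _ (\sum_(i < d) e / d.+1%:R)).
  apply: ler_sum => i _; rewrite !mxE ltW// mP//.
  by rewrite (leq_trans _ mk)// leq_bigmax.
rewrite sumr_const card_ord -[ltLHS]mulr_natr mulrAC ltr_pdivrMr// ltr_pM2l//.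
by rewrite ltr_nat.
Qed.

Lemma cVdotE x y : cVdot x y = (y ^t* *m x) 0 0.
Proof.
rewrite mxE; apply: eq_bigr => i _.
by rewrite !mxE mulrC.
Qed.

Lemma cVdot_adjoint M x y : cVdot (M *m x) y = cVdot x (M ^t* *m y).
Proof. by rewrite !cVdotE trmx_mul map_mxM trmxCK mulmxA. Qed.

(** M^* M is Hermitian, so the spectral theorem gives a unitary [P] diagonalising it, and the
    columns of P^* are the [W i]. The last sum is the trace of P M P^*, which is that of [M]. *)
Lemma singular_basis M : exists (W : 'I_d -> 'cV[R[i]]_d),
  [/\ orthonormal cVdot setT W, total cVdot setT W,
      forall x i, cVdot (M *m x) (M *m W i) = (N (M *m W i) ^+ 2)%:C%C * cVdot x (W i)
    & \sum_i cVdot (M *m W i) (W i) = \tr M].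
Proof.
pose A := M ^t* *m M; pose P := spectralmx A.
have uP : P \is unitarymx by exact: spectral_unitarymx.
have AP : A = P^t* *m diag_mx (spectral_diag A) *m P.
  rewrite -(invmx_unitary uP); apply/orthomx_spectralP/normalmxP.
  by rewrite /A trmx_mul map_mxM trmxCK.
pose W i := col i (P^t*).
have WE (f : 'M[R[i]]_d) i j : cVdot (f *m W i) (W j) = (P *m f *m P^t*) j i.
  rewrite cVdotE /W -mulmxA [RHS]mxE mxE; apply: eq_bigr => k _.
  by rewrite !mxE conjCK; congr *%R; apply: eq_bigr => l _; rewrite !mxE.
have oW : orthonormal cVdot setT W.
  move=> i j _ _; rewrite -[W i]mul1mx WE mulmx1 (unitarymxP uP) !mxE eq_sym.
  by [].
have AW i : A *m W i = spectral_diag A 0 i *: W i.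
  rewrite {1}AP /W colE -!mulmxA (mulmxA P) (unitarymxP uP) mul1mx scalemxAr.
  congr mulmx; apply/colP => k; rewrite mul_diag_mx !mxE.
  by case: eqVneq => [->|]; rewrite ?mulr0.
have MW x i : cVdot (M *m x) (M *m W i) = (spectral_diag A 0 i)^*%C * cVdot x (W i).
  by rewrite cVdot_adjoint mulmxA -/A AW (dotZr ip).
exists W; split => //.
- move=> x e e0; exists (enum 'I_d), (fun i => (P *m x) i 0); split => //.
  rewrite (_ : _ - _ = 0) ?(hnorm0 ip)//; apply/eqP; rewrite subr_eq0 big_enum/=.
  rewrite -[X in X == _]mul1mx -(mulmx1C (unitarymxP uP)) -mulmxA; apply/eqP/colP => k.
  rewrite mxE summxE; apply: eq_bigr => i _.
  by rewrite !mxE mulrC.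
- move=> x i; rewrite MW; congr *%R.
  (* The eigenvalue is identified at the unit vector [x = W i], which also shows that it is real and
     nonnegative. *)
  have := MW (W i) i; rewrite (dot_hnorm ip) oW// eqxx mulr1.
  by move=> ->.
- under eq_bigr do rewrite WE.
  by rewrite -[LHS]/(\tr _) mxtrace_mulC mulmxA (mulmx1C (unitarymxP uP)) mul1mx.
Qed.

Lemma mulmx_bounded M : bounded_operator (@cVdot R d) (mulmx M).
Proof.
exists (\sum_i N (M *m delta_mx i 0)) => x.
rewrite [X in M *m X](_ : x = \sum_i x i 0 *: delta_mx i 0); last first.
  by rewrite [LHS]matrix_sum_delta; apply: eq_bigr => i _; rewrite big_ord1.
rewrite mulmx_sumr (le_trans (hnorm_sum ip _ _ _))// mulr_suml ler_sum// => i _.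
rewrite -scalemxAr (hnormZ ip) mulrC ler_wpM2l ?hnorm_ge0//.
exact: normc_le_hnorm.
Qed.

End column_vectors.

(** * Completeness of [L^2] *)

Lemma ltn_exp2S j : (j < 2 ^ j.+1)%N.
Proof. by rewrite (ltn_trans (ltnSn j))// ltn_expl. Qed.

Section real_L2.
Context {disp : measure_display} {X : measurableType disp} {R : realType}.
Variable mu : {finite_measure set X -> \bar R}.
Implicit Types f g : X -> R.

Definition int2 f : \bar R := (\int[mu]_x (f x ^+ 2)%:E)%E.

Lemma int2_ge0 f : (0 <= int2 f)%E.
Proof. by apply: integral_ge0 => x _; rewrite lee_fin sqr_ge0. Qed.

Lemma Lfun2P f : f \in Lfun mu 2%:E <->
  measurable_fun setT f /\ (int2 f < +oo)%E.
Proof.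
have E g : (\int[mu]_x `|(g x)%:E| `^ 2 = int2 g)%E.
  apply: eq_integral => x _.
  by rewrite abse_EFin poweR_EFin powR_mulrn// -normrX ger0_norm ?sqr_ge0.
split.
    move=> fL; have := fL; rewrite inE => /andP[/[!inE]/= mf _]; split => //.
  have /integrableP[_] := Lfun2_integrable_sqr fL.
  apply: le_lt_trans; rewrite le_eqVlt; apply/orP; left; apply/eqP.
  by apply: eq_integral => x _ /=; rewrite ger0_norm ?sqr_ge0.
move=> [mf fi]; apply/andP; split; rewrite inE//=.
rewrite /finite_norm unlock.
rewrite (_ : (\int[mu]_x _)%E = int2 f); first by rewrite poweR_lty.
exact: E.
Qed.

Lemma Lfun2B f g : f \in Lfun mu 2%:E -> g \in Lfun mu 2%:E ->
  (fun x => f x - g x) \in Lfun mu 2%:E.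
Proof.
have le12 : (1 <= 2%:E :> \bar R)%E by rewrite lee_fin ler1n.
have [L0 LZD] := Lfun_submod_closed mu le12.
move=> fL gL; rewrite (_ : (fun _ => _) = (- 1) *: g + f); first exact: LZD.
by apply/funext => x; rewrite !fctE scaleN1r addrC.
Qed.

(* [|u| <= c u^2 + 1 / c]; with [c = 2^k] it turns increments of squared [L^2]-norm
   [4^-k] into summable [L^1]-increments. *)
Lemma le_integral_norm_sqr (u : X -> R) (c : R) : measurable_fun setT u -> 0 < c ->
  (\int[mu]_x `|u x|%:E <= c%:E * int2 u + (c^-1)%:E * mu setT)%E.
Proof.
move=> mu_ c0.
have mu2 : measurable_fun setT (fun x => (u x ^+ 2)%:E).
  by apply/measurable_EFinP; exact: measurable_funX.
have c1 : 0 <= c^-1 by rewrite invr_ge0 ltW.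
apply: (@le_trans _ _ (\int[mu]_x (c%:E * (u x ^+ 2)%:E + (c^-1)%:E))%E).
  apply: ge0_le_integral => //.
  - by apply/measurable_EFinP; exact: measurableT_comp.
  - by apply: emeasurable_funD => //; exact: emeasurable_funM.
  - move=> x _; rewrite -EFinM -EFinD lee_fin.
    rewrite -[X in c * X]ger0_norm ?sqr_ge0// normrX; move: `|u x| => t.
    (* Completing the square in [c * t]. *)
    rewrite -subr_ge0 (_ : _ - _ = c^-1 * ((c * t - 2^-1) ^+ 2 + 3 / 4)); last first.
      by field; rewrite gt_eqF.
    by rewrite mulr_ge0// addr_ge0 ?sqr_ge0.
rewrite ge0_integralD//=; last 2 first.
- by move=> x _; rewrite -EFinM lee_fin mulr_ge0 ?sqr_ge0 ?ltW.
- exact: emeasurable_funM.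
rewrite integral_cst// ge0_integralZl_EFin//; last exact: ltW.
by move=> x _; rewrite lee_fin sqr_ge0.
Qed.

(** The integrals of the terms add up to at most [c], so the sum of the series is integrable and
    hence finite almost everywhere. *)
Lemma ae_series_fin (D : nat -> X -> R) (c : R) : 0 <= c ->
  (forall k, measurable_fun setT (D k)) -> (forall k x, 0 <= D k x) ->
  (forall k, \int[mu]_x (D k x)%:E <= (c / (2 ^ k.+1)%:R)%:E)%E ->
  {ae mu, forall x, \sum_(0 <= k <oo) (D k x)%:E < +oo}%E.
Proof.
move=> c0 mD D0 Dc; pose S x := (\sum_(0 <= k <oo) (D k x)%:E)%E.
have mS : measurable_fun setT S.
  apply: ge0_emeasurable_sum => [k x _ _|k _]; first by rewrite lee_fin.
  exact/measurable_EFinP.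
have S0 x : (0 <= S x)%E by apply: nneseries_ge0 => k _ _; rewrite lee_fin.
have Sfin : (\int[mu]_x S x < +oo)%E.
  rewrite integral_nneseries//; last 2 first.
  - by move=> k; exact/measurable_EFinP.
  - by move=> k x _; rewrite lee_fin.
  apply: (@le_lt_trans _ _ (\sum_(0 <= k <oo) (c / (2 ^ k.+1)%:R)%:E)%E).
    apply: lee_nneseries => [k _ _|k _]; last exact: Dc.
    by apply: integral_ge0 => x _; rewrite lee_fin.
  by rewrite (le_lt_trans (epsilon_trick0 xpredT c0))// ltry.
have : mu.-integrable setT S.
  apply/integrableP; split => //; apply: le_lt_trans Sfin.
  rewrite le_eqVlt; apply/orP; left; apply/eqP; apply: eq_integral => x _.
  by rewrite gee0_abs.
move=> /(integrable_ae measurableT); apply: filterS => x /(_ I).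
by rewrite ge0_fin_numE.
Qed.

Lemma cvg_summable_increments (g : nat -> R) :
  (\sum_(0 <= k <oo) `|g k.+1 - g k|%:E < +oo)%E -> cvgn g.
Proof.
move=> /(nnseries_is_cvg (fun=> normr_ge0 _))/normed_cvg gc.
have -> : g = (fun n => g 0%N + series (fun k => g k.+1 - g k) n).
  by apply/funext => n; rewrite /series/= telescope_sumr// addrC subrK.
by apply: is_cvgD => //; exact: is_cvg_cst.
Qed.

(** Almost everywhere the lower limit of (u - g k)^2 is (u - h)^2, so a bound on distances to the
    [g k] passes to their pointwise limit. *)
Lemma int2_fatou (u h : X -> R) (g : nat -> X -> R) (e : \bar R) :
  measurable_fun setT u -> measurable_fun setT h ->
  (forall k, measurable_fun setT (g k)) ->
  {ae mu, forall x, (g^~ x) @ \oo --> h x} ->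
  (\forall k \near \oo, int2 (fun x => u x - g k x)%R <= e)%E ->
  (int2 (fun x => u x - h x)%R <= e)%E.
Proof.
move=> mu_ mh mg gh ge.
pose F j x : \bar R := ((u x - g j x) ^+ 2)%:E.
have mF j : measurable_fun setT (F j).
  by apply/measurable_EFinP; apply: measurable_funX; exact: measurable_funB.
have F0 j x : setT x -> (0 <= F j x)%E by rewrite lee_fin sqr_ge0.
have FE x : (g^~ x) @ \oo --> h x -> limn_einf (F^~ x) = ((u x - h x) ^+ 2)%:E.
  move=> gx.
  suff cF : (F^~ x) @ \oo --> ((u x - h x) ^+ 2)%:E.
    by have [-> _] := cvg_limn_einf_sup cF.
  apply: cvg_EFin; first by near=> k.
  have : (fun k => u x - g k x) @ \oo --> u x - h x by apply: cvgB => //; exact: cvg_cst.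
  by move=> ux; rewrite expr2; apply: cvgM.
rewrite [leLHS](_ : _ = \int[mu]_x limn_einf (F^~ x))%E; last first.
  apply: ge0_ae_eq_integral => //.
  - by apply/measurable_EFinP; apply: measurable_funX; exact: measurable_funB.
  - under eq_fun do rewrite -[limn_einf _]oppeK -limn_esupN.
    apply: measurableT_comp => //; apply: measurable_fun_limn_esup => k.
    exact: measurableT_comp.
  - by move=> x _; rewrite lee_fin sqr_ge0.
  - move=> x _; rewrite limn_einf_lim; apply: lime_ge; first exact: is_cvg_einfs.
    near=> k; apply: le_ereal_inf_tmp => _ [j _ <-]; exact: F0.
  - by apply: filterS gh => x gx _; rewrite FE.
apply: le_trans (fatou mu measurableT mF F0) _.
rewrite limn_einf_lim; apply: lime_le; first exact: is_cvg_einfs.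
apply: filterS ge => k; apply: le_trans; apply: ereal_inf_lbound.
by exists k => /=.
Unshelve. all: by end_near.
Qed.

(* Riesz-Fischer: a fast subsequence has integrable total variation, so it
   converges almost everywhere, and Fatou's lemma bounds the distance to its
   limit. *)
Lemma L2_complete_real (f : nat -> X -> R) : (forall n, f n \in Lfun mu 2%:E) ->
  (forall e : R, 0 < e -> exists n, forall k l, (n <= k)%N -> (n <= l)%N ->
     (int2 (fun x => f k x - f l x)%R < e%:E)%E) ->
  exists2 g, g \in Lfun mu 2%:E &
    forall e : R, 0 < e -> exists n, forall k, (n <= k)%N ->
     (int2 (fun x => f k x - g x)%R <= e%:E)%E.
Proof.
move=> fL fC.
have mf n : measurable_fun setT (f n) by have [] := (Lfun2P (f n)).1 (fL n).
pose e k : R := ((2 ^ k.+1)%:R ^- 2).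
have e0 k : 0 < e k by rewrite invr_gt0 exprn_gt0// ltr0n expn_gt0.
have /choice[p pP] k := fC _ (e0 k).
(* Running maxima put every [g j] with [j >= k] beyond the threshold [p k]; in particular [g k] and
   [g k.+1] are at squared distance less than [e k]. *)
pose n k := (\max_(j < k.+1) p j)%N.
have np k j : (j <= k)%N -> (p j <= n k)%N.
  by move=> jk; rewrite /n (bigD1 (Ordinal (jk : (j < k.+1)%N)))//= leq_max leqnn.
pose g k := f (n k).
have [c cE] : exists c : R, mu setT = c%:E.
  by exists (fine (mu setT)); rewrite fineK ?fin_num_measure.
have c0 : 0 <= c by rewrite -lee_fin -cE.
have gfin : {ae mu, forall x, (\sum_(0 <= k <oo) `|g k.+1 x - g k x|%:E < +oo)%E}.
  apply: (@ae_series_fin (fun k x => `|g k.+1 x - g k x|) (1 + c)) => //.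
  - by rewrite addr_ge0.
  - move=> k; apply: measurableT_comp => //; apply: measurable_funB; exact: mf.
  - move=> k; set z : R := (2 ^ k.+1)%:R.
    have z0 : 0 < z by rewrite ltr0n expn_gt0.
    apply: le_trans (le_integral_norm_sqr _ z0) _.
      by apply: measurable_funB; exact: mf.
    apply: (@le_trans _ _ (z%:E * (e k)%:E + (z^-1)%:E * mu setT)%E).
      rewrite leeD2r// lee_pmul2l ?lte_fin// ltW//.
      by apply: pP; rewrite np.
    rewrite cE -!EFinM -EFinD lee_fin /e -/z.
    by rewrite le_eqVlt; apply/orP; left; apply/eqP; field; rewrite gt_eqF.
(* The upper limit is measurable and defined at every point; where [g] diverges, [fine] still
   returns a real number, and this happens on a null set only. *)
pose h x := fine (limn_esup (fun k => (g k x)%:E)).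
have mh : measurable_fun setT h.
  apply: measurableT_comp => //.
  by apply: measurable_fun_limn_esup => k; apply/measurable_EFinP; exact: mf.
have gh : {ae mu, forall x, (g^~ x) @ \oo --> h x}.
  apply: filterS gfin => x /cvg_summable_increments/cvg_ex[l gl].
  rewrite /h (_ : limn_esup _ = l%:E)//.
  suff cg : (fun k => (g k x)%:E) @ \oo --> l%:E.
    by have [_ ->] := cvg_limn_einf_sup cg.
  by apply: cvg_EFin => //; near=> k.
have key k m : (p k <= m)%N -> (int2 (fun x => f m x - h x)%R <= (e k)%:E)%E.
  move=> km; apply: (@int2_fatou (f m) h g) => //; first by move=> j; exact: mf.
  by exists k => // j /= kj; rewrite ltW// pP// np.
exists h.
  rewrite (_ : h = fun x => f (p 0%N) x - (f (p 0%N) x - h x)); last first.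
    by apply/funext => x; rewrite opprB addrC subrK.
  apply: Lfun2B => //; apply/Lfun2P; split; first exact: measurable_funB.
  by rewrite (le_lt_trans (key 0%N _ (leqnn _)))// ltry.
move=> t t0; have [k kt] : exists k, e k <= t.
  pose k := Num.truncn t^-1; exists k.
  rewrite /e -exprVn; set z : R := (2 ^ k.+1)%:R.
  have tz : t^-1 < z.
    apply: lt_le_trans (truncnS_gt _) _; rewrite ler_nat -/k.
      exact: ltn_exp2S.
  have z0 : 0 < z by rewrite ltr0n expn_gt0.
  have z1 : 1 <= z by rewrite ler1n expn_gt0.
  rewrite (@le_trans _ _ z^-1)//.
    rewrite expr2 ger_pMl ?invr_gt0// invf_le1//.
  by rewrite ltW// invf_plt ?posrE.
by exists (p k) => m km; rewrite (le_trans (key _ _ km)).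
Unshelve. all: by end_near.
Qed.

End real_L2.

(** * The Hilbert space of complex square-integrable classes *)

Section complex_L2.
Context {disp : measure_display} {X : measurableType disp} {R : realType}.
Variable mu : {finite_measure set X -> \bar R}.
Implicit Types (f g h : X -> R[i]).

Definition cintegrable h : Prop :=
  mu.-integrable setT (EFin \o (Re \o h)) /\ mu.-integrable setT (EFin \o (Im \o h)).

Definition cint h : R[i] :=
  Complex (Rintegral mu setT (Re \o h)) (Rintegral mu setT (Im \o h)).

Lemma innerE f g : inner mu f g = cint (fun x => f x * (g x)^*%C).
Proof. by []. Qed.

Lemma cintZD a g h : cintegrable g -> cintegrable h ->
  cint (fun x => a * g x + h x) = a * cint g + cint h.
Proof.
move=> [gr gi] [hr hi]; case: a => a b.
have int_lin (u v w : X -> R) (p q : R) :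
    mu.-integrable setT (EFin \o u) -> mu.-integrable setT (EFin \o v) ->
    mu.-integrable setT (EFin \o w) ->
    (\int[mu]_(x in setT) (p * u x + q * v x + w x) =
     p * \int[mu]_(x in setT) u x + q * \int[mu]_(x in setT) v x +
     \int[mu]_(x in setT) w x)%R.
  move=> iu iv iw.
  have iz (z : X -> R) t : mu.-integrable setT (EFin \o z) ->
      mu.-integrable setT (EFin \o (fun x => t * z x)).
    move=> iz; rewrite (_ : _ \o _ = (fun x => t%:E * (z x)%:E)%E)//.
    exact: integrableZl.
  rewrite RintegralD//; last first.
    rewrite (_ : _ \o _ = (fun x => (p * u x)%:E + (q * v x)%:E)%E)//.
    by apply: integrableD => //; exact: iz.
  by rewrite RintegralD ?RintegralZl//; exact: iz.
rewrite /cint /=; apply/eqP; rewrite eq_complex /=; apply/andP; split; apply/eqP.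
  rewrite -mulNr -int_lin//; congr Rintegral; apply/funext => x /=.
  by case: (g x) (h x) => [? ?] [? ?] /=; rewrite mulNr.
rewrite -int_lin//; congr Rintegral; apply/funext => x /=.
by case: (g x) (h x) => [? ?] [? ?].
Qed.

Lemma cint_conj g : cintegrable g -> cint (fun x => (g x)^*%C) = (cint g)^*%C.
Proof.
move=> [_ gi]; rewrite /cint /=; apply/eqP; rewrite eq_complex /=.
apply/andP; split; apply/eqP.
  by congr Rintegral; apply/funext => x /=; case: (g x).
rewrite -mulN1r -RintegralZl//; congr Rintegral; apply/funext => x /=.
by rewrite mulN1r; case: (g x).
Qed.

Lemma sqint_Re f : f \in sqint mu -> (Re \o f) \in Lfun mu 2%:E.
Proof. by rewrite unfold_in => /andP[]. Qed.

Lemma sqint_Im f : f \in sqint mu -> (Im \o f) \in Lfun mu 2%:E.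
Proof. by rewrite unfold_in => /andP[]. Qed.

Lemma cintegrable_mul f g : f \in sqint mu -> g \in sqint mu ->
  cintegrable (fun x => f x * (g x)^*%C).
Proof.
move=> fs gs.
have prod (u v : X -> R) : u \in Lfun mu 2%:E -> v \in Lfun mu 2%:E ->
    mu.-integrable setT (fun x => (u x * v x)%:E).
  by move=> us vs; apply/Lfun1_integrable; exact: Lfun2_mul_Lfun1.
have rr := prod _ _ (sqint_Re fs) (sqint_Re gs).
have ri := prod _ _ (sqint_Re fs) (sqint_Im gs).
have ir := prod _ _ (sqint_Im fs) (sqint_Re gs).
have ii := prod _ _ (sqint_Im fs) (sqint_Im gs).
split.
  rewrite (_ : _ \o _ = (fun x => (Re (f x) * Re (g x))%:E + (Im (f x) * Im (g x))%:E)%E).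
    exact: integrableD.
  by apply/funext => x /=; case: (f x) (g x) => [? ?] [? ?] /=; rewrite mulrN opprK.
rewrite (_ : _ \o _ = (fun x => (Im (f x) * Re (g x))%:E - (Re (f x) * Im (g x))%:E)%E).
  exact: integrableB.
by apply/funext => x /=; case: (f x) (g x) => [? ?] [? ?] /=; rewrite mulrN -EFinB addrC.
Qed.

Lemma int2_fin (u : X -> R) : u \in Lfun mu 2%:E -> int2 mu u = (fine (int2 mu u))%:E.
Proof.
by move=> /Lfun2P[_ ufin]; rewrite fineK// ge0_fin_numE// int2_ge0.
Qed.

Lemma inner_self f : f \in sqint mu ->
  inner mu f f = (fine (int2 mu (Re \o f)) + fine (int2 mu (Im \o f)))%:C%C.
Proof.
move=> fs; rewrite innerE /cint /=; apply/eqP; rewrite eq_complex /=.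
have ir := Lfun2_integrable_sqr (sqint_Re fs).
have ii := Lfun2_integrable_sqr (sqint_Im fs).
apply/andP; split; apply/eqP.
  rewrite -[RHS](RintegralD measurableT ir ii); congr Rintegral; apply/funext => x /=.
  by case: (f x) => [? ?] /=; rewrite mulrN opprK.
rewrite (_ : _ \o _ = cst 0) ?Rintegral_cst// ?mul0r//.
by apply/funext => x /=; case: (f x) => [? ?] /=; rewrite mulrN mulrC addNr.
Qed.

Lemma inner_ae f f' g g' : f \in sqint mu -> f' \in sqint mu ->
  g \in sqint mu -> g' \in sqint mu ->
  {ae mu, forall x, f x = f' x} -> {ae mu, forall x, g x = g' x} ->
  inner mu f g = inner mu f' g'.
Proof.
move=> fs f's gs g's ff' gg'; rewrite !innerE /cint.
have [i1 i2] := cintegrable_mul fs gs; have [i1' i2'] := cintegrable_mul f's g's.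
congr Complex; rewrite /Rintegral; congr fine; apply: ae_eq_integral => //.
- exact: measurable_int i1.
- exact: measurable_int i1'.
- by apply: filterS2 ff' gg' => x fx gx _ /=; rewrite fx gx.
- exact: measurable_int i2.
- exact: measurable_int i2'.
- by apply: filterS2 ff' gg' => x fx gx _ /=; rewrite fx gx.
Qed.

Lemma innerZDl a f g h : f \in sqint mu -> g \in sqint mu -> h \in sqint mu ->
  inner mu (a *: f + g) h = a * inner mu f h + inner mu g h.
Proof.
move=> fs gs hs; rewrite !innerE -cintZD; [|exact: cintegrable_mul..].
by congr cint; apply/funext => x; rewrite !fctE mulrDl -mulrA.
Qed.

Lemma inner0l f : inner mu 0 f = 0.
Proof.
rewrite innerE /cint (_ : _ \o _ = cst 0); last first.
  by apply/funext => x /=; case: (f x) => [? ?]; rewrite /= !mul0r subr0.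
rewrite (_ : Im \o _ = cst 0) ?Rintegral_cst ?mul0r//.
by apply/funext => x /=; case: (f x) => [? ?]; rewrite /= !mul0r addr0.
Qed.

Lemma innerZl a f g : f \in sqint mu -> g \in sqint mu ->
  inner mu (a *: f) g = a * inner mu f g.
Proof.
have [s0 _] := sqint_submod_closed mu.
by move=> fs gs; rewrite -[a *: f]addr0 innerZDl// inner0l addr0.
Qed.

Lemma inner_conj f g : f \in sqint mu -> g \in sqint mu ->
  inner mu g f = (inner mu f g)^*%C.
Proof.
move=> fs gs; rewrite !innerE -cint_conj; last exact: cintegrable_mul.
by congr cint; apply/funext => x; rewrite conjcM conjcK mulrC.
Qed.

Lemma int2_eq0 (u : X -> R) : u \in Lfun mu 2%:E -> fine (int2 mu u) = 0 ->
  {ae mu, forall x, u x = 0}.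
Proof.
move=> us u0; have [mu_ _] := (Lfun2P _ _).1 us.
have mu2 : measurable_fun setT (fun x => (u x ^+ 2)%:E).
  by apply/measurable_EFinP; exact: measurable_funX.
have : (\int[mu]_x `|(u x ^+ 2)%:E| = 0)%E.
  transitivity (int2 mu u); last by rewrite int2_fin// u0.
  by apply: eq_integral => x _; rewrite gee0_abs// lee_fin sqr_ge0.
move=> /(ae_eq_integral_abs mu measurableT mu2); apply: filterS => x /(_ I) [].
by move=> /eqP; rewrite sqrf_eq0 => /eqP.
Qed.

Local Open Scope quotient_scope.
Local Notation pi := (\pi_(L2 mu)).

Lemma sqfunP (f : sqfun mu) : (f : X -> R[i]) \in sqint mu.
Proof. by case: f. Qed.

Lemma L2fun_sqint (u : L2 mu) : L2fun u \in sqint mu.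
Proof. exact: sqfunP. Qed.

(** [L2fun] selects a representative of the class, which need not be [f]; this is why functions and
    classes are related almost everywhere throughout. *)
Lemma L2fun_pi (f : sqfun mu) : {ae mu, forall x, L2fun (pi f) x = f x}.
Proof.
have : repr (pi f) - f \in nullfun (mu := mu) by apply/eqL2P; rewrite reprK.
by move=> /asboolP; apply: filterS => x /= /eqP; rewrite !fctE subr_eq0 => /eqP.
Qed.

Lemma L2_eq (u v : L2 mu) : {ae mu, forall x, L2fun u x = L2fun v x} -> u = v.
Proof.
move=> uv; rewrite -[u]reprK -[v]reprK; apply/eqL2P/asboolP.
by apply: filterS uv => x /= uvx; rewrite !fctE -[_ x]/(L2fun u x) uvx subrr.
Qed.

Lemma L2fun_linear a (u v : L2 mu) :
  {ae mu, forall x, L2fun (a *: u + v) x = a * L2fun u x + L2fun v x}.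
Proof.
have -> : a *: u + v = pi (a *: (repr u : sqfun mu) + repr v).
  rewrite -[in LHS](reprK v).
  by rewrite [RHS]Quotient.pi_add.
exact: L2fun_pi.
Qed.

Lemma L2fun_sum (I : Type) (F : seq I) (c : I -> R[i]) (u : I -> L2 mu)
    (f : I -> X -> R[i]) : (forall i, {ae mu, forall x, L2fun (u i) x = f i x}) ->
  {ae mu, forall x, L2fun (\sum_(i <- F) c i *: u i) x = \sum_(i <- F) c i * f i x}.
Proof.
move=> uf; elim: F => [|i F ih].
  (* The representative of 0 is not known to be the zero function. Writing 0 = (-1) 0 + 0 shows that
     it is -g + g = 0 almost everywhere. *)
  rewrite big_nil; have := L2fun_linear (-1) 0 0; rewrite scaler0 addr0.
  by apply: filterS => x ->; rewrite mulN1r addNr big_nil.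
rewrite big_cons; have := L2fun_linear (c i) (u i) (\sum_(i <- F) c i *: u i).
by apply: filterS3 ih (uf i) => x ihx ufx ->; rewrite big_cons ihx ufx.
Qed.

Lemma L2dot_inner_product : inner_product (L2dot (mu := mu)).
Proof.
split.
- move=> a u v w; rewrite /L2dot -innerZDl; try exact: L2fun_sqint.
  apply: inner_ae; try exact: L2fun_sqint.
  + have [_ LZD] := sqint_submod_closed mu.
    exact: LZD (L2fun_sqint _) (L2fun_sqint _).
  + exact: L2fun_linear.
  + exact: aeW.
- by move=> u v; apply: inner_conj; exact: L2fun_sqint.
- move=> u; rewrite /L2dot inner_self ?L2fun_sqint// ler0c addr_ge0//.
    by rewrite fine_ge0// int2_ge0.
  by rewrite fine_ge0// int2_ge0.
- move=> u; rewrite /L2dot inner_self ?L2fun_sqint// => -[/eqP].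
  rewrite paddr_eq0 ?fine_ge0 ?int2_ge0// => /andP[/eqP r0 /eqP i0].
  apply: L2_eq.
  have := int2_eq0 (sqint_Re (L2fun_sqint u)) r0.
  have := int2_eq0 (sqint_Im (L2fun_sqint u)) i0.
  have := L2fun_linear (-1) 0 0; rewrite scaler0 addr0.
  apply: filterS3 => x /= -> ui ur; rewrite mulN1r addNr; move: ui ur.
  by case: (L2fun u x) => [? ?] /= -> ->.
Qed.

Lemma hnorm_L2 (u : L2 mu) f : f \in sqint mu -> {ae mu, forall x, L2fun u x = f x} ->
  hnorm (L2dot (mu := mu)) u ^+ 2 =
  fine (int2 mu (Re \o f)) + fine (int2 mu (Im \o f)).
Proof.
move=> fs uf; rewrite (hnorm_sqr L2dot_inner_product) /L2dot.
by rewrite (inner_ae _ fs _ fs)// ?L2fun_sqint// inner_self.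
Qed.

Lemma L2_sub_ae (u v : L2 mu) f g : {ae mu, forall x, L2fun u x = f x} ->
  {ae mu, forall x, L2fun v x = g x} ->
  {ae mu, forall x, L2fun (u - v) x = f x - g x}.
Proof.
move=> uf vg; have := L2fun_linear (-1) v u; rewrite scaleN1r addrC.
by apply: filterS3 uf vg => x -> -> ->; rewrite mulN1r addrC.
Qed.

Lemma sqint_sub f g : f \in sqint mu -> g \in sqint mu ->
  (fun x => f x - g x) \in sqint mu.
Proof.
have [_ LZD] := sqint_submod_closed mu.
move=> fs gs; rewrite (_ : (fun _ => _) = (- 1) *: g + f); first exact: LZD.
by apply/funext => x; rewrite !fctE scaleN1r addrC.
Qed.

Lemma L2_complete : hcomplete (L2dot (mu := mu)).
Proof.
move=> u uC; pose f n := L2fun (u n).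
have fs n : f n \in sqint mu by exact: L2fun_sqint.
have hE m n : hnorm (L2dot (mu := mu)) (u m - u n) ^+ 2 =
    fine (int2 mu (fun x => Re (f m x) - Re (f n x))) +
    fine (int2 mu (fun x => Im (f m x) - Im (f n x))).
  rewrite (@hnorm_L2 _ (fun x => f m x - f n x)) ?sqint_sub//; last first.
    by apply: L2_sub_ae; exact: aeW.
  by congr +%R; congr fine; congr int2; apply/funext => x /=;
    case: (f m x) (f n x) => [? ?] [].
have [gr grL grP] : exists2 g, g \in Lfun mu 2%:E &
    forall e : R, 0 < e -> exists n, forall k, (n <= k)%N ->
     (int2 mu (fun x => Re (f k x) - g x)%R <= e%:E)%E.
  apply: (@L2_complete_real _ _ _ mu (fun n => Re \o f n)) => [n|e e0].
    exact: sqint_Re.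
  have se0 : 0 < Num.sqrt e by rewrite sqrtr_gt0.
  have [n nP] := uC _ se0; exists n => k l nk nl.
  have L2kl := Lfun2B (sqint_Re (fs k)) (sqint_Re (fs l)).
  rewrite (int2_fin L2kl) lte_fin.
  have : hnorm (L2dot (mu := mu)) (u k - u l) ^+ 2 < e.
    rewrite -[ltRHS](sqr_sqrtr (ltW e0)).
    by rewrite ltr_pXn2r ?nnegrE ?hnorm_ge0 ?(ltW se0)// nP.
  rewrite hE; apply: le_lt_trans.
  by rewrite lerDl fine_ge0// int2_ge0.
have [gi giL giP] : exists2 g, g \in Lfun mu 2%:E &
    forall e : R, 0 < e -> exists n, forall k, (n <= k)%N ->
     (int2 mu (fun x => Im (f k x) - g x)%R <= e%:E)%E.
  apply: (@L2_complete_real _ _ _ mu (fun n => Im \o f n)) => [n|e e0].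
    exact: sqint_Im.
  have se0 : 0 < Num.sqrt e by rewrite sqrtr_gt0.
  have [n nP] := uC _ se0; exists n => k l nk nl.
  have L2kl := Lfun2B (sqint_Im (fs k)) (sqint_Im (fs l)).
  rewrite (int2_fin L2kl) lte_fin.
  have : hnorm (L2dot (mu := mu)) (u k - u l) ^+ 2 < e.
    rewrite -[ltRHS](sqr_sqrtr (ltW e0)).
    by rewrite ltr_pXn2r ?nnegrE ?hnorm_ge0 ?(ltW se0)// nP.
  rewrite hE; apply: le_lt_trans.
  by rewrite lerDr fine_ge0// int2_ge0.
pose g x := Complex (gr x) (gi x).
have gs : g \in sqint mu by rewrite unfold_in; apply/andP; split.
exists (pi (SqFun gs)); apply/cvg_seqP => e e0.
(* The bounds on the real and imaginary parts are weak inequalities; quarters leave room for a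
   strict one on their sum. *)
have e20 : 0 < e ^+ 2 / 4 by rewrite divr_gt0 ?exprn_gt0.
have [n1 h1] := grP _ e20; have [n2 h2] := giP _ e20.
exists (maxn n1 n2) => k; rewrite geq_max => /andP[k1 k2].
rewrite subr0 ger0_norm ?hnorm_ge0//.
rewrite -(ltr_pXn2r (n := 2)) ?nnegrE ?hnorm_ge0 ?(ltW e0)//.
rewrite (@hnorm_L2 _ (fun x => f k x - g x)) ?sqint_sub//; last first.
  by apply: L2_sub_ae; [exact: aeW | exact: L2fun_pi].
have := h1 _ k1; have := h2 _ k2.
have -> : (fun x => Re (f k x) - gr x) = Re \o (fun x => f k x - g x).
  by apply/funext => x /=; case: (f k x).
have -> : (fun x => Im (f k x) - gi x) = Im \o (fun x => f k x - g x).
  by apply/funext => x /=; case: (f k x).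
have ks := sqint_sub (fs k) gs.
rewrite (int2_fin (sqint_Re ks)) (int2_fin (sqint_Im ks)) !lee_fin.
have q : e ^+ 2 / 4 < e ^+ 2 / 2.
  by rewrite ltr_pM2l ?exprn_gt0// ltf_pV2 ?posrE// ltr_nat.
move=> hi hr; rewrite (splitr (e ^+ 2)).
by apply: ltrD; [exact: le_lt_trans hr q | exact: le_lt_trans hi q].
Qed.

End complex_L2.

(** * Block-diagonal operators *)

Section schatten_diagonal.
Context {R : realType} {V : lmodType R[i]} (dot : V -> V -> R[i]).
Hypothesis ip : inner_product dot.
Hypothesis cV : hcomplete dot.
Context {I : choiceType} (w : I -> V).
Hypothesis ow : orthonormal dot setT w.
Hypothesis tw : total dot setT w.
Context (T : {linear V -> V}) (s : I -> R).
Hypothesis bT : bounded_operator dot T.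
Hypothesis s_ge0 : forall i, 0 <= s i.
Hypothesis Ts : forall x i, dot (T x) (T (w i)) = (s i ^+ 2)%:C%C * dot x (w i).
Context (r : R) (r0 : 0 < r).
Let S : \bar R := (\esum_(i in setT) (s i `^ r)%:E)%E.

Let S_ge0 : (0 <= S)%E.
Proof. by apply: esum_ge0 => i _; rewrite lee_fin powR_ge0. Qed.

Lemma compact_summable : (S < +oo)%E -> compact_operator dot T.
Proof.
move=> Sfin; apply: (diagonal_compact ip cV ow tw bT s_ge0 Ts) => e e0.
exact: (summable_finite_gt s_ge0 r0 e0).
Qed.

Lemma schatten_norm_compact : compact_operator dot T ->
  schatten_norm dot r T = poweR S r^-1.
Proof.
move=> cT; rewrite /schatten_norm; case: asboolP => // _.
by rewrite (esum_singular_values ip ow tw s_ge0 Ts r0).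
Qed.

(** If [T] is not compact, [S] is infinite by [compact_summable], in agreement with the value [+oo]
    of [schatten_norm]; so the identity holds inside and outside the Schatten class. *)
Lemma poweR_schatten_norm : poweR (schatten_norm dot r T) r = S.
Proof.
have rn0 : r != 0 by rewrite gt_eqF.
have [cT|ncT] := pselect (compact_operator dot T).
  by rewrite schatten_norm_compact// -poweRrM mulVf// poweRe1.
rewrite /schatten_norm; case: asboolP => // _; rewrite poweRyr//.
apply/esym/eqP; rewrite -leye_eq leNgt; apply/negP => /compact_summable.
exact: ncT.
Qed.

Lemma schatten_class_summable : schatten_class dot r T <-> (S < +oo)%E.
Proof.
split=> [[cT]|Sfin].
  by move=> h; rewrite -poweR_schatten_norm; exact: poweR_lty.
have cT := compact_summable Sfin; split => //.
by rewrite schatten_norm_compact//; exact: poweR_lty.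
Qed.

End schatten_diagonal.

(** * Transport between the blocks C^(d l) and the Hilbert space *)

Section block_operator.
Context {R : realType} {V : lmodType R[i]} (dot : V -> V -> R[i]).
Hypothesis ip : inner_product dot.
Hypothesis cV : hcomplete dot.
Context (d : nat -> nat).
Local Notation I := {l & 'I_(d l)}.
Local Notation tg l m := (Tagged (fun l => 'I_(d l)) (m : 'I_(d l))).
Context (b : I -> V).
Hypothesis ob : orthonormal dot setT b.
Hypothesis tb : total dot setT b.
Context (T : {linear V -> V}) (sigma : forall l, 'M[R[i]]_(d l)).
Hypothesis bT : bounded_operator dot T.
Local Notation N := (hnorm dot).

Definition coef (x : V) (l : nat) : 'cV[R[i]]_(d l) := \col_k dot x (b (tg l k)).
(** The isometry of C^(d l) onto the span of the block [l]; it is the adjoint of [coef], by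
    [dot_embed]. *)
Definition embed (l : nat) (z : 'cV[R[i]]_(d l)) : V := \sum_k z k 0 *: b (tg l k).

Hypothesis sT : forall i l, coef (T (b i)) l = sigma l *m coef (b i) l.

Lemma dot_embed x l z : dot x (embed z) = cVdot (coef x l) z.
Proof.
rewrite /embed (dot_sumr ip) /cVdot; apply: eq_bigr => k _.
by rewrite (dotZr ip) mxE mulrC.
Qed.

Lemma coef_embed l (z : 'cV[R[i]]_(d l)) : coef (embed z) l = z.
Proof.
apply/colP => k; rewrite mxE /embed (dot_suml ip) (bigD1 k)//= (dotZl ip) ob//.
rewrite eqxx mulr1 big1 ?addr0// => m mk.
rewrite (dotZl ip) ob// -tag_eqE /tag_eq/= eqxx tagged_asE.
by rewrite (negbTE mk) mulr0.
Qed.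

Lemma coef_embed_neq l l' (z : 'cV[R[i]]_(d l)) : l != l' -> coef (embed z) l' = 0.
Proof.
move=> ll'; apply/colP => k; rewrite !mxE /embed (dot_suml ip) big1// => m _.
by rewrite (dotZl ip) ob// -tag_eqE /tag_eq/= (negbTE ll') mulr0.
Qed.

Lemma embed_delta l k : embed (delta_mx k 0) = b (tg l k).
Proof.
rewrite /embed (bigD1 k)//= mxE !eqxx scale1r big1 ?addr0// => m mk.
by rewrite mxE (negbTE mk) scale0r.
Qed.

(** Tested against [z], the claim says that the functional x -> (T x, u) - (x, v) is zero. It
    vanishes on the [b i] by [sT], hence on their span, and it is bounded by C |u| + |v|; density
    concludes. *)
Lemma coef_image x l : coef (T x) l = sigma l *m coef x l.
Proof.
have [C C0 CT] := bounded_ge0 bT.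
suff adj z : dot (T x) (embed z) = dot x (embed ((sigma l) ^t* *m z)).
  apply/colP => k; rewrite [LHS]mxE -embed_delta adj dot_embed -cVdot_adjoint.
  rewrite /cVdot (bigD1 k)//= big1 ?addr0; last first.
    by move=> m mk; rewrite !mxE (negbTE mk) conjc0 mulr0.
  by rewrite [X in _ * X^*%C]mxE !eqxx conjc1 mulr1.
set u := embed z; set v := embed _.
have bi i : dot (T (b i)) u = dot (b i) v.
  by rewrite /u /v !dot_embed sT cVdot_adjoint.
apply/eqP; rewrite -subr_eq0; apply/eqP/eq0_normc/eqP.
rewrite eq_le normc_ge0 andbT; apply/ler_addgt0Pr => e e0; rewrite add0r.
have K0 : 0 < C * N u + N v + 1.
  by rewrite ltr_wpDl// addr_ge0 ?mulr_ge0 ?hnorm_ge0.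
have [F [c [_ xF]]] := tb x (divr_gt0 e0 K0).
set y := \sum_(i <- F) _ in xF.
have yE : dot (T y) u = dot y v.
  rewrite /y linear_sum !(dot_suml ip); apply: eq_bigr => i _.
  by rewrite linearZ !(dotZl ip) bi.
rewrite (_ : _ - _ = dot (T (x - y)) u - dot (x - y) v); last first.
  by rewrite linearB !(dotBl ip) yE opprB addrA subrK.
rewrite (le_trans (le_normcD _ _))// normcN.
rewrite (@le_trans _ _ ((C * N u + N v) * N (x - y)))//.
  rewrite mulrDl lerD//.
    rewrite (le_trans (cauchy_schwarz ip _ _))// mulrAC ler_wpM2r ?hnorm_ge0//.
  by rewrite mulrC cauchy_schwarz.
rewrite ltr_pdivlMr// in xF; rewrite (le_trans _ (ltW xF))// mulrC.
by rewrite ler_wpM2l ?hnorm_ge0// lerDl.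
Qed.

Lemma image_embed l (z : 'cV[R[i]]_(d l)) : T (embed z) = embed (sigma l *m z).
Proof.
apply: (total_inj ip ob tb) => -[l' k] _.
have /colP/(_ k) := coef_image (embed z) l'; rewrite mxE => ->.
have -> : dot (embed (sigma l *m z)) (b (tg l' k)) =
  coef (embed (sigma l *m z)) l' k 0 by rewrite mxE.
case: (eqVneq l l') => [ll'|ll'].
  by subst l'; rewrite !coef_embed.
by rewrite !coef_embed_neq// mulmx0.
Qed.

Lemma dot_embed_embed l (z z' : 'cV[R[i]]_(d l)) :
  dot (embed z) (embed z') = cVdot z z'.
Proof. by rewrite dot_embed coef_embed. Qed.

Context (W : forall l, 'I_(d l) -> 'cV[R[i]]_(d l)).
Hypothesis oW : forall l, orthonormal cVdot setT (W (l := l)).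
Hypothesis tW : forall l, total cVdot setT (W (l := l)).

Definition block_basis (i : I) : V := embed (W (tagged i)).

Lemma block_basis_orthonormal : orthonormal dot setT block_basis.
Proof.
move=> [l k] [l' k'] _ _; rewrite /block_basis/= -tag_eqE /tag_eq/=.
case: (eqVneq l l') => [ll'|ll'].
  by subst l'; rewrite dot_embed_embed oW// tagged_asE.
by rewrite dot_embed coef_embed_neq// /cVdot big1// => m _; rewrite mxE mul0r.
Qed.

Lemma embed_sum l (J : finType) (c : J -> R[i]) (z : J -> 'cV[R[i]]_(d l)) :
  embed (\sum_j c j *: z j) = \sum_j c j *: embed (z j).
Proof.
rewrite /embed; under [RHS]eq_bigr do rewrite scaler_sumr.
rewrite exchange_big/=; apply: eq_bigr => k _; rewrite summxE scaler_suml.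
by apply: eq_bigr => j _; rewrite mxE scalerA.
Qed.

(** The indices of the first [n] blocks: the exhaustion along which the trace is computed. *)
Definition block_seq n : seq I := [seq tg l m | l <- iota 0 n, m <- enum 'I_(d l)].

Lemma mem_block_seq n i : (i \in block_seq n) = (tag i < n)%N.
Proof.
apply/allpairsPdep/idP => [[l [m [+ _ ->]]]|]; first by rewrite mem_iota.
by case: i => l m /= ln; exists l, m; rewrite mem_iota mem_enum.
Qed.

Lemma block_seq_uniq n : uniq (block_seq n).
Proof.
apply: allpairs_uniq_dep => [|l _|]; rewrite ?iota_uniq ?enum_uniq//.
move=> [l m] [l' m'] _ _ /= e.
have ll' : l = l' by rewrite -[l]/(tag (tg l m)) e.
subst l'; move/eqP: e; rewrite -tag_eqE /tag_eq/= eqxx tagged_asE => /eqP ->.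
by [].
Qed.

Lemma big_block_seq (U : nmodType) n (f : I -> U) :
  \sum_(i <- block_seq n) f i = \sum_(0 <= l < n) \sum_(m < d l) f (tg l m).
Proof.
rewrite /block_seq big_allpairs_dep /index_iota subn0.
by apply: eq_bigr => l _; rewrite big_enum.
Qed.

(** A finite combination of the [b i] meets finitely many blocks, and in each of them [b i] is
    recovered from its coefficients in the basis [W l]. *)
Lemma block_basis_total : total dot setT block_basis.
Proof.
move=> x e /(tb x)[F [c [_ xF]]].
pose n := (\max_(i <- F) (tag i).+1)%N.
exists (block_seq n), (fun j => dot (\sum_(i <- F) c i *: b i) (block_basis j)).
split => //; rewrite (_ : \sum_(j <- block_seq n) _ = \sum_(i <- F) c i *: b i)//.
under eq_bigr => j _.
  rewrite (dot_suml ip); under eq_bigr do rewrite (dotZl ip).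
  rewrite scaler_suml; under eq_bigr do rewrite -scalerA.
  over.
rewrite exchange_big/=; apply: eq_big_seq => -[l k] iF; rewrite -scaler_sumr.
congr (_ *: _).
have ln : (l < n)%N by rewrite /n (big_rem _ iF)/= leq_max leqnn.
rewrite big_block_seq (bigD1_seq l) ?mem_index_iota ?iota_uniq//=.
rewrite [X in _ + X]big1_seq ?addr0; last first.
  move=> l' /andP[ll' _]; rewrite big1// => m _.
  rewrite /block_basis -embed_delta dot_embed coef_embed_neq 1?eq_sym//.
  by rewrite /cVdot big1 ?scale0r// => k' _; rewrite mxE mul0r.
rewrite -embed_delta; under eq_bigr do rewrite dot_embed_embed.
rewrite -embed_sum; congr embed.
apply: (total_inj cVdot_inner_product (oW (l := l)) (tW (l := l))) => k' _.
rewrite -big_enum (dot_comb cVdot_inner_product (oW (l := l))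
  (fun m => cVdot (delta_mx k 0) (W m)))//.
  by rewrite mem_enum.
exact: enum_uniq.
Qed.

End block_operator.

(** * Schatten norm and trace of a block-diagonal operator *)

Section matrix_symbol.
Context {R : realType} {V : lmodType R[i]} (dot : V -> V -> R[i]).
Hypothesis ip : inner_product dot.
Hypothesis cV : hcomplete dot.
Context (d : nat -> nat).
Local Notation I := {l & 'I_(d l)}.
Context (b : I -> V).
Hypothesis ob : orthonormal dot setT b.
Hypothesis tb : total dot setT b.
Context (T : {linear V -> V}) (sigma : forall l, 'M[R[i]]_(d l)).
Hypothesis bT : bounded_operator dot T.
Hypothesis sT : forall i l, coef dot b (T (b i)) l = sigma l *m coef dot b (b i) l.

(** The embedded singular bases of the [sigma l] form the basis [w]. By [coef_image] the singular
    relation of a block becomes that of [T], with the same number [s i], so the diagonal theory on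
    both sides gives one sum over all indices, grouped by [l]. *)
Theorem schatten_block_operator (r : R) : 0 < r ->
  [/\ schatten_class dot r T <->
        (\sum_(0 <= l <oo)
           poweR (schatten_norm cVdot r (mulmx (sigma l))) r < +oo)%E,
      poweR (schatten_norm dot r T) r =
        (\sum_(0 <= l <oo)
           poweR (schatten_norm cVdot r (mulmx (sigma l))) r)%E
    & schatten_class dot 1 T ->
        exists2 t : R[i], has_trace dot T t &
          cvgc (fun N => \sum_(0 <= l < N) \tr (sigma l)) t].
Proof.
move=> r0.
have /(_ _)/cid-/all_sig[W WP] l := singular_basis (sigma l).
have oW l : orthonormal cVdot setT (W l) by have [] := WP l.
have tW l : total cVdot setT (W l) by have [] := WP l.
have sW l x m : cVdot (sigma l *m x) (sigma l *m W l m) =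
    (hnorm cVdot (sigma l *m W l m) ^+ 2)%:C%C * cVdot x (W l m).
  by have [_ _ + _] := WP l; apply.
pose w := block_basis b W.
pose s (i : I) := hnorm cVdot (sigma (tag i) *m W (tag i) (tagged i)).
have s0 i : 0 <= s i by exact: hnorm_ge0.
have ow : orthonormal dot setT w by exact: block_basis_orthonormal.
have tw : total dot setT w by exact: block_basis_total.
have Ts x i : dot (T x) (T (w i)) = (s i ^+ 2)%:C%C * dot x (w i).
  case: i => l m; rewrite /w /block_basis /= (image_embed ip ob tb bT sT).
  by rewrite !(dot_embed ip) (coef_image ip tb bT sT) sW.
have sE (q : R) : 0 < q ->
    (\esum_(i in setT) (s i `^ q)%:E = \sum_(0 <= l <oo)
       poweR (schatten_norm cVdot q (mulmx (sigma l))) q)%E.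
  move=> q0; rewrite esum_sigT; last by move=> i; rewrite lee_fin powR_ge0.
  apply: eq_eseriesr => l _.
  rewrite (poweR_schatten_norm cVdot_inner_product (@cVdot_complete _ _) (oW l) (tW l)
    (mulmx_bounded (sigma l)) (fun m => hnorm_ge0 _ _) (sW l) q0).
  by rewrite esum_ord// => m; rewrite lee_fin powR_ge0.
split.
- by rewrite -sE//; exact: (schatten_class_summable ip cV ow tw bT s0 Ts r0).
- by rewrite -sE//; exact: (poweR_schatten_norm ip cV ow tw bT s0 Ts r0).
move=> /(schatten_class_summable ip cV ow tw bT s0 Ts ltr01) sfin.
pose F n := block_seq d n.
have uF n : uniq (F n) by exact: block_seq_uniq.
(* Since |T w_i| = s_i, the finite Schatten sum of exponent 1 bounds all partial sums, as the trace
   argument demands. *)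
have FB n : \sum_(i <- F n) hnorm dot (T (w i)) <=
    fine (\esum_(i in setT) (s i `^ 1)%:E)%E.
  rewrite -lee_fin fineK; last first.
    by rewrite ge0_fin_numE// esum_ge0// => i _; rewrite lee_fin powR_ge0.
  have := @esum_seq_le R I setT (fun i => (s i `^ 1)%:E) (F n) (uF n)
    (fun _ _ => Logic.I).
  apply: le_trans; rewrite -sumEFin lee_sum// => i _; rewrite lee_fin.
  by rewrite (hnorm_image ip ow s0 Ts) powRr1.
have F_mono n m : (n <= m)%N -> {subset F n <= F m}.
  by move=> nm i; rewrite !mem_block_seq => /leq_trans; exact.
have F_exh i : exists n, i \in F n by exists (tag i).+1; rewrite mem_block_seq.
have [t Tt tP] := trace_cvg ip ow tw bT uF F_mono F_exh FB.
exists t => //; move: tP; rewrite (_ : (fun n => \sum_(i <- F n) _) =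
  fun n => \sum_(0 <= l < n) \tr (sigma l))//.
apply/funext => n; rewrite big_block_seq; apply: eq_bigr => l _.
have [_ _ _ <-] := WP l; apply: eq_bigr => m _.
rewrite /w /block_basis /= (image_embed ip ob tb bT sT).
by rewrite (dot_embed_embed ip ob).
Qed.

End matrix_symbol.

(** * Smooth functions *)

Section smooth_functions.
Context {R : realType}.

Lemma continuous_near_eq (T U : topologicalType) (f g : T -> U) (x : T) :
  {near x, f =1 g} -> {for x, continuous f} -> {for x, continuous g}.
Proof.
move=> fg fx; have fgx : f x = g x by exact: nbhs_singleton fg.
rewrite /prop_for /continuous_at -fgx; apply: cvg_trans fx.
by apply: near_eq_cvg; apply: filterS fg => y.
Qed.

(** A derivative at a point depends only on the values nearby and [U] is open, so the formula for
    [w], known on all of [U], can be differentiated once more. *)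
Lemma partials_linear m (U : set 'rV[R]_m) (f g : 'rV[R]_m -> R) (a : R) w x :
  open U -> smooth_on U f -> smooth_on U g -> U x ->
  partials w (fun y => a * f y + g y) x = a * partials w f x + partials w g x.
Proof.
move=> oU fs gs; elim: w x => [//|i w ih] x Ux.
have [_ /(_ i) fi] := fs w x Ux; have [_ /(_ i) gi] := gs w x Ux.
have fgE := deriveD (derivableZ (k := a) fi) gi.
rewrite (deriveZ a fi) in fgE; rewrite [RHS](esym fgE) /=; apply: near_eq_derive.
by apply: filterS (open_nbhs_nbhs (conj oU Ux)) => y /ih.
Qed.

Lemma smooth_on_linear m (U : set 'rV[R]_m) (f g : 'rV[R]_m -> R) (a : R) :
  open U -> smooth_on U f -> smooth_on U g ->
  smooth_on U (fun y => a * f y + g y).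
Proof.
move=> oU fs gs w x Ux.
have E : {near x, a \*: partials w f + partials w g =1
    partials w (fun y => a * f y + g y)}.
  apply: filterS (open_nbhs_nbhs (conj oU Ux)) => y Uy.
  by rewrite (partials_linear _ _ oU fs gs Uy).
have [fc fd] := fs w x Ux; have [gc gd] := gs w x Ux; split.
  apply: continuous_near_eq E _.
  exact: (continuousD (continuousZl_tmp (k := a) fc) gc).
move=> i; apply: near_eq_derivable E _.
by apply: derivableD => //; exact: derivableZ.
Qed.

Lemma csmooth_on_linear m (U : set 'rV[R]_m) (f g : 'rV[R]_m -> R[i]) (a : R[i]) :
  open U -> csmooth_on U f -> csmooth_on U g ->
  csmooth_on U (fun y => a * f y + g y).
Proof.
move=> oU [fr fi] [gr gi]; case: a => a b; split.
  rewrite (_ : _ \o _ = fun y => a * (Re \o f) y + (- b * (Im \o f) y + (Re \o g) y)).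
    exact: (smooth_on_linear a oU fr (smooth_on_linear (- b) oU fi gr)).
  apply/funext => y /=; case: (f y) (g y) => [? ?] [? ?] /=.
  by rewrite mulNr addrA.
rewrite (_ : _ \o _ = fun y => a * (Im \o f) y + (b * (Re \o f) y + (Im \o g) y)).
  exact: (smooth_on_linear a oU fi (smooth_on_linear b oU fr gi)).
by apply/funext => y /=; case: (f y) (g y) => [? ?] [? ?] /=; rewrite addrA.
Qed.

Context {n : nat} {M : ptopologicalType} (A : set (chart R n M)).
Hypothesis cA : closed_manifold A.

Lemma smooth_linear (a : R[i]) (f g : M -> R[i]) :
  smooth A f -> smooth A g -> smooth A (a *: f + g).
Proof.
move=> fs gs c Ac; have [_ _ [hA _ _]] := cA.
have [_ oI _ _ _] := hA c Ac.
exact: (csmooth_on_linear a oI (fs c Ac) (gs c Ac)).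
Qed.

(** Near a point, [f] is its local expression composed with the chart map; smoothness at the empty
    word [[::]] is continuity of that expression. *)
Lemma smooth_continuous (f : M -> R[i]) : smooth A f ->
  continuous (Re \o f : M -> R) /\ continuous (Im \o f : M -> R).
Proof.
move=> fs; have [_ _ [hA cov _]] := cA.
suff : forall p, {for p, continuous (Re \o f : M -> R)} /\
    {for p, continuous (Im \o f : M -> R)}.
  by move=> h; split => p; have [] := h p.
move=> p; have [c Ac pc] := cov p; have [oD oI invK mapc _] := hA c Ac.
have [fr fi] := fs c Ac.
have Ip : chart_img c (chart_map c p) by exists p.
have key (g : 'rV[R]_n -> R) (h : M -> R) : smooth_on (chart_img c) g ->
    (forall q, chart_dom c q -> g (chart_map c q) = h q) ->
    {for p, continuous h}.
  move=> gs gh; have [gc _] := gs [::] _ Ip.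
  apply: (@continuous_near_eq _ _ (g \o chart_map c)).
    by apply: filterS (open_nbhs_nbhs (conj oD pc)) => q /gh.
  apply: continuous_comp; last exact: gc.
  exact: mapc.
by split; [apply: key fr _ | apply: key fi _] => q qc /=; rewrite invK.
Qed.

Variable mu : {finite_measure set (borel M) -> \bar R}.

Lemma continuous_borel_measurable (f : M -> R) : continuous f ->
  measurable_fun [set: borel M] f.
Proof.
move=> /continuousP cf; apply: (measurability _ (RGenOpens.measurableE R)).
move=> _ [_ [a [b ->] <-]]; rewrite setTI; apply: sub_sigma_algebra.
exact/cf/interval_open.
Qed.

(** A continuous function is bounded on the compact [M], and [mu] is finite. *)
Lemma continuous_Lfun2 (f : M -> R) : continuous f ->
  (f : borel M -> R) \in Lfun mu 2%:E.
Proof.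
move=> cf; have [_ cM _] := cA.
have mf := continuous_borel_measurable cf.
apply/Lfun2P; split => //.
have : compact (f @` [set: M]).
  by apply: continuous_compact => //; exact: continuous_subspaceT.
move=> /compact_bounded/pinfty_ex_gt0[B B0 fB].
apply: (@le_lt_trans _ _ (\int[mu]_x (B ^+ 2)%:E)%E).
  apply: ge0_le_integral => //.
  - by move=> x _; rewrite lee_fin sqr_ge0.
  - by apply/measurable_EFinP; exact: measurable_funX.
  - move=> x _; rewrite lee_fin -[leLHS]ger0_norm ?sqr_ge0// normrX.
    by rewrite ler_pXn2r ?nnegrE ?normr_ge0 ?(ltW B0)//; apply: fB; exists x.
rewrite integral_cst//; apply: lte_mul_pinfty => //.
  by rewrite lee_fin sqr_ge0.
by have := fin_num_measure mu _ measurableT; rewrite ge0_fin_numE.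
Qed.

Lemma smooth_sqint (f : M -> R[i]) : smooth A f -> (f : borel M -> R[i]) \in sqint mu.
Proof.
move=> /smooth_continuous[fr fi]; rewrite unfold_in; apply/andP.
by split; exact: continuous_Lfun2.
Qed.

(** Positivity enters as reality: a nonnegative element of [R[i]] has zero imaginary part, so Im (E
    h, h) = 0 for h = z f + g. Expanding with the two eigenvalues leaves a - b times one part of (f,
    g). *)
Lemma positive_eigenfunctions_orthogonal (E : (M -> R[i]) -> (M -> R[i]))
    (f g : M -> R[i]) (a b : R) :
  smooth_operator A E -> positive_operator A mu E ->
  smooth A f -> smooth A g -> E f = a%:C%C *: f -> E g = b%:C%C *: g ->
  a != b -> inner mu f g = 0.
Proof.
move=> [_ Elin] Epos fs gs Ef Eg ab.
have fS := smooth_sqint fs; have gS := smooth_sqint gs.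
have imz z : Im (inner mu (E (z *: f + g)) (z *: f + g)) = 0.
  by apply: ger0_Im; apply: Epos; exact: smooth_linear.
have [L0 LZD] := sqint_submod_closed mu.
(* Polarisation: [z = 1] and [z = i] give the imaginary and real parts of
   [(a - b) (f, g) = 0]. *)
have key z : Im (z * a%:C%C * (z * inner mu f f + inner mu g f)^*%C +
                 b%:C%C * (z * inner mu f g + inner mu g g)^*%C) = 0.
  have hS : z *: f + g \in sqint mu by exact: LZD.
  have bgS : b%:C%C *: g \in sqint mu by rewrite -[X in X \in _]addr0; exact: LZD.
  rewrite -[RHS](imz z) Elin// Ef Eg scalerA innerZDl// innerZl// -!innerZDl//.
  by rewrite -!inner_conj.
have ffR : Im (inner mu f f) = 0 by rewrite inner_self.
have ggR : Im (inner mu g g) = 0 by rewrite inner_self.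
have := key 1; have := key (Complex 0 1).
rewrite (inner_conj fS gS); move: ffR ggR.
have : a - b != 0 by rewrite subr_eq0.
case: (inner mu f f) (inner mu g g) (inner mu f g) => [p p'] [q q'] [t t'] /= ab0 -> ->.
move=> h1 h2; have tr : (a - b) * t = 0 by rewrite -[RHS]h1; ring.
have ti : (a - b) * t' = 0 by rewrite -[RHS]h2; ring.
move/eqP: tr; rewrite mulf_eq0 (negbTE ab0)/= => /eqP ->.
by move/eqP: ti; rewrite mulf_eq0 (negbTE ab0)/= => /eqP ->.
Qed.

End smooth_functions.

(** * Application to the eigenbasis of [E] *)

Theorem theorem3p3 (R : realType) (n : nat) (M : ptopologicalType)
    (A : set (chart R n M)) (mu : {finite_measure set (borel M) -> \bar R})
    (nu r : R) (E : (M -> R[i]) -> (M -> R[i])) (lam : nat -> R)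
    (d : nat -> nat) (e : forall j, 'I_(d j) -> M -> R[i])
    (T : {linear L2 mu -> L2 mu}) (sigma : forall l, 'M[R[i]]_(d l)) :
  closed_manifold A -> smooth_positive_density A mu ->
  0 < nu -> Psi_pe A mu nu E -> eigenbasis A mu E lam e ->
  0 < r ->
  bounded_operator (L2dot (mu := mu)) T ->
  invariant_with_symbol A e T sigma ->
  [/\ schatten_class (L2dot (mu := mu)) r T <->
        (\sum_(0 <= l <oo)
           poweR (schatten_norm cVdot r (mulmx (sigma l))) r < +oo)%E,
      poweR (schatten_norm (L2dot (mu := mu)) r T) r =
        (\sum_(0 <= l <oo)
           poweR (schatten_norm cVdot r (mulmx (sigma l))) r)%E
    & schatten_class (L2dot (mu := mu)) 1 T ->
        exists2 t : R[i], has_trace (L2dot (mu := mu)) T t &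
          cvgc (fun N => \sum_(0 <= l < N) \tr (sigma l)) t].
Proof.
move=> cM _ _ [[sE _] _ pE] eb r0 bT inv.
have es j (k : 'I_(d j)) : smooth A (e j k) by exact: (e_smooth eb).
have eS j (k : 'I_(d j)) : (e j k : borel M -> R[i]) \in sqint mu.
  exact: (@smooth_sqint R n M A cM mu _ (es j k)).
pose b (i : {l & 'I_(d l)}) : L2 mu :=
  (\pi_(L2 mu) (SqFun (eS (tag i) (tagged i))))%qT.
have be i : {ae mu, forall x, L2fun (b i) x = e (tag i) (tagged i) x}.
  exact: L2fun_pi.
have dote i j : L2dot (b i) (b j) =
    inner mu (e (tag i) (tagged i)) (e (tag j) (tagged j)).
  by apply: inner_ae; rewrite ?L2fun_sqint.
have ob : orthonormal (L2dot (mu := mu)) setT b.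
  move=> [l k] [l' k'] _ _; rewrite dote -tag_eqE /tag_eq/=.
  case: (eqVneq l l') => [ll'|ll'].
    by subst l'; rewrite (e_orthonormal eb) tagged_asE.
  rewrite andFb.
  have := @positive_eigenfunctions_orthogonal R n M A cM mu E _ _ _ _ sE pE
    (es l k) (es l' k') (e_eigen eb k) (e_eigen eb k').
  apply; move: ll'; rewrite neq_ltn => /orP[] /(lam_increasing eb) ll'.
    by rewrite lt_eqF.
  by rewrite gt_eqF.
have tb : total (L2dot (mu := mu)) setT b.
  move=> x eps eps0; have [K [c]] := e_total eb (L2fun_sqint x) eps0.
  set h := (_ - _) => hK; exists (block_seq d K), (fun i => c (tag i) (tagged i)).
  split => //; apply: le_lt_trans hK; rewrite le_eqVlt; apply/orP; left; apply/eqP.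
  pose c' (i : {l & 'I_(d l)}) := c (tag i) (tagged i).
  pose f (x : M) : R[i] := \sum_(i <- block_seq d K) c' i * e (tag i) (tagged i) x.
  have hE : h = (fun x0 => L2fun x x0 - f x0).
    apply/funext => p; rewrite /h !fctE; congr (_ - _).
    rewrite /f big_block_seq big_mkord fct_sumE; apply: eq_bigr => j _.
    by rewrite fct_sumE.
  (* The combination of the classes represents the combination of the eigenfunctions almost
     everywhere, which is enough for equal norms. *)
  have yh : {ae mu, forall p, L2fun (x - \sum_(i <- block_seq d K) c' i *: b i) p = h p}.
    rewrite hE; apply: L2_sub_ae; first exact: aeW.
    exact: (L2fun_sum _ _ be).
  have hs : (h : borel M -> R[i]) \in sqint mu.
    have [L0 LZD] := sqint_submod_closed mu.
    have Ls F : (\sum_(i <- F) c' i *: e (tag i) (tagged i)) \in sqint mu.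
      elim: F => [|i F ih]; first by rewrite big_nil.
      by rewrite big_cons; exact: LZD.
    rewrite hE; apply: sqint_sub; first exact: L2fun_sqint.
    rewrite (_ : f = \sum_(i <- block_seq d K) c' i *: e (tag i) (tagged i)).
      exact: Ls.
    by apply/funext => p; rewrite fct_sumE.
  rewrite /hnorm; congr (Num.sqrt (Re _)).
  by apply: inner_ae; rewrite ?L2fun_sqint.
(* Invariance is applied to the eigenfunctions themselves: they are smooth, and [b i] is the class
   of one of them. *)
have sT i l : coef (L2dot (mu := mu)) b (T (b i)) l =
    sigma l *m coef (L2dot (mu := mu)) b (b i) l.
  have cE (u : L2 mu) f : (f : borel M -> R[i]) \in sqint mu ->
      {ae mu, forall x, L2fun u x = f x} ->
      coef (L2dot (mu := mu)) b u l = fcoef mu e f l.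
    move=> fs uf; apply/colP => k; rewrite !mxE.
    by apply: inner_ae; rewrite ?L2fun_sqint.
  rewrite (cE _ (L2fun (T (b i))))// ?L2fun_sqint//; last exact: aeW.
  by rewrite (cE _ _ (eS _ _) (be i)); exact: inv.
have := schatten_block_operator (L2dot_inner_product mu) (@L2_complete _ _ _ mu)
  ob tb bT sT r0.
(* Without this unfolding the conversion with the goal takes twice as long. *)
by rewrite /reverse_coercion.
Qed.
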